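(* For the periodic quantum graph of the trihexagonal tiling with edge length $a$ and potentials $q_1,\dots,q_6$ on its six classes of edges, the dispersion relation is $\Phi(\rho)=0$, where the characteristic function $\Phi$ is given by $$\begin{aligned}\Phi(\rho)=-e^{2i(\theta_1+\theta_2)}\big\{&2\big[(S_1S_2S_4+S_3S_5S_6)\cos\theta_1+(S_1S_3S_5+S_2S_4S_6)\cos(\theta_1-\theta_2)\\&\quad+(S_1S_4S_5+S_2S_3S_6)\cos\theta_2+S_1S_2S_3+S_4S_5S_6\big]\\&+(S_2S_3S_4S_5)'\big(2\cos\theta_2-((CS)_{16})'\big)+(CSSS)_{1346}\big(2\cos(\theta_1-\theta_2)-((CS)_{25})'\big)\\&-(S_1S_6)'(S_2S_5)'(CS)_{34}-(S_3S_4)'(CS)_{25}(CS)_{16}\\&+\big(S_1S_6(CS)_{25}+S_2S_5(S_1S_6)'\big)\big(2\cos\theta_1-((CS)_{34})'\big)\big\}.\end{aligned}$$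
   Context: Let $a>0$, $q_1,\dots,q_6\in L^2(0,a)$ real-valued (not assumed identical or even), $\rho\in\mathbb C$, $\lambda=\rho^2$. Let $C_j(x,\rho),S_j(x,\rho)$ be the solutions of $-y''+q_jy=\rho^2y$ on $[0,a]$ with $C_j(0,\rho)=S_j'(0,\rho)=1$, $C_j'(0,\rho)=S_j(0,\rho)=0$; abbreviate $C_j=C_j(a,\rho)$, $C_j'=C_j'(a,\rho)$, $S_j=S_j(a,\rho)$, $S_j'=S_j'(a,\rho)$. A prime on a product denotes the product rule, e.g. $(S_1S_6)'=S_1'S_6+S_1S_6'$, and similarly for $(S_2S_3S_4S_5)'$ (sum of four terms). Further, $(CS)_{ij}=C_iS_j+C_jS_i$, $((CS)_{ij})'=C_i'S_j+C_iS_j'+C_j'S_i+C_jS_i'$, and $(CSSS)_{1346}=C_1S_3S_4S_6+C_3S_1S_4S_6+C_4S_1S_3S_6+C_6S_1S_3S_4$. The graph is periodic with respect to $\vec k_1=(\sqrt3a,a)$, $\vec k_2=(0,2a)$; modulo translations it has vertices $v_1,v_2,v_3$ and edges $e_1:v_1\to v_3$, $e_2:v_3\to v_2$, $e_3:v_1\to v_2$, $e_4:v_1\to v_2-\vec k_1$, $e_5:v_3-\vec k_2\to v_2-\vec k_1$, $e_6:v_1\to v_3-\vec k_2$, each parametrized by $[0,a]$ in the indicated direction and carrying potential $q_j$. For a quasi-momentum $\Theta=(\theta_1,\theta_2)\in[-\pi,\pi]^2$, the Bloch Hamiltonian $H^\Theta$ acts as $-y''+q_jy$ on edges, on functions satisfying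 the continuity–Kirchhoff condition at vertices and $y(x+p_1\vec k_1+p_2\vec k_2)=e^{i(p_1\theta_1+p_2\theta_2)}y(x)$, $p_1,p_2\in\mathbb Z$. Writing $y_j=A_jC_j(x,\rho)+B_jS_j(x,\rho)$ on $e_j$, and $\widetilde\alpha=e^{i\theta_1}$, $\widetilde\beta=e^{i\theta_2}$, these conditions become a homogeneous linear system in the unknowns ordered $(A_1,\dots,A_6,B_1,\dots,B_6)$. The characteristic function $\Phi(\rho)$ is the determinant of the $12\times12$ matrix whose rows are, in order, the coefficients of the linear forms 1. $A_1-A_3$ 2. $A_1-A_4$ 3. $A_1-A_6$ 4. $B_1+B_3+B_4+B_6$ 5. $C_2A_2-C_3A_3+S_2B_2-S_3B_3$ 6. $C_2A_2-\widetilde\alpha C_4A_4+S_2B_2-\widetilde\alpha S_4B_4$ 7. $C_2A_2-\widetilde\alpha C_5A_5+S_2B_2-\widetilde\alpha S_5B_5$ 8. $C_2'A_2+C_3'A_3+\widetilde\alpha C_4'A_4+\widetilde\alpha C_5'A_5+S_2'B_2+S_3'B_3+\widetilde\alpha S_4'B_4+\widetilde\alpha S_5'B_5$ 9. $A_2-\widetilde\beta A_5$ 10. $A_2-\widetilde\beta C_6A_6-\widetilde\beta S_6B_6$ 11. $-C_1A_1+A_2-S_1B_1$ 12. $C_1'A_1+\widetilde\beta C_6'A_6+S_1'B_1-B_2-\widetilde\beta B_5+\widetilde\beta S_6'B_6$. Thus $\rho^2\in\sigma(H^\Theta)$ if and only if $\Phi(\rho)=0$. *)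

(* Defs.v *)
From HB Require Import structures.
From mathcomp Require Import all_boot all_order all_algebra.
From mathcomp Require Import complex.
From mathcomp Require Import all_classical all_reals all_analysis.

Set Implicit Arguments.
Unset Strict Implicit.
Unset Printing Implicit Defensive.

Import Order.TTheory GRing.Theory Num.Theory.
Import numFieldNormedType.Exports.

Local Open Scope ring_scope.
Local Open Scope complex_scope.
Local Open Scope classical_set_scope.

Section Analysis.
Context {R : realType}.
Local Notation C := R[i].
Local Notation mu := (@lebesgue_measure R).

Definition expi (t : R) : C := cos t +i* sin t.

Definition cintegrable (D : set R) (f : R -> C) : Prop :=
  mu.-integrable D (EFin \o (fun x => complex.Re (f x))) /\
  mu.-integrable D (EFin \o (fun x => complex.Im (f x))).

Definition cintegral (D : set R) (f : R -> C) : C :=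
  (\int[mu]_(x in D) complex.Re (f x))%R +i*
  (\int[mu]_(x in D) complex.Im (f x))%R.

(* F is absolutely continuous on [0, a] and F' = f almost everywhere. *)
Definition ac_primitive (a : R) (F f : R -> C) : Prop :=
  cintegrable `[0, a] f /\
  forall x, 0 <= x <= a -> F x = F 0 + cintegral `[0, x] f.

Definition L2sq (a : R) (f : R -> C) : \bar R :=
  (\int[mu]_(x in `[0%R, a])
     (complex.Re (f x) ^+ 2 + complex.Im (f x) ^+ 2)%R%:E)%E.

Definition isL2 (a : R) (f : R -> C) : Prop :=
  [/\ measurable_fun `[0, a] (fun x => complex.Re (f x)),
      measurable_fun `[0, a] (fun x => complex.Im (f x)) &
      (L2sq a f < +oo)%E].

(* y and y' = dy are absolutely continuous on [0, a] and - y'' + q y = g almost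
   everywhere, i.e. dy is a primitive of q y - g. *)
Definition sturm_liouville (a : R) (q : R -> R) (y dy g : R -> C) : Prop :=
  ac_primitive a y dy /\
  ac_primitive a dy (fun x => (q x)%:C * y x - g x).

Definition solution (a : R) (q : R -> R) (lambda : C) (y dy : R -> C) : Prop :=
  sturm_liouville a q y dy (fun x => lambda * y x).

End Analysis.

(* The period lattice: (p1, p2) stands for the translation p1 k1 + p2 k2. *)
Definition cell : Type := (int * int)%type.
Definition vertex : Type := ('I_3 * cell)%type.
Definition edge : Type := ('I_6 * cell)%type.

(* Trihexagonal tiling with vertices v_1, v_2, v_3 and edges e_1, ..., e_6 per
   period, stored with indices starting from 0. The edges are
     e_1 : v_1 -> v_3,       e_2 : v_3 -> v_2,            e_3 : v_1 -> v_2,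
     e_4 : v_1 -> v_2 - k1,  e_5 : v_3 - k2 -> v_2 - k1,  e_6 : v_1 -> v_3 - k2. *)
Definition src0 (j : 'I_6) : vertex :=
  tnth [tuple (inord 0, (0, 0)); (inord 2, (0, 0)); (inord 0, (0, 0));
              (inord 0, (0, 0)); (inord 2, (0, -1)); (inord 0, (0, 0))] j.

Definition tgt0 (j : 'I_6) : vertex :=
  tnth [tuple (inord 2, (0, 0)); (inord 1, (0, 0)); (inord 1, (0, 0));
              (inord 1, (-1, 0)); (inord 1, (-1, 0)); (inord 2, (0, -1))] j.

Definition src (e : edge) : vertex := ((src0 e.1).1, e.2 + (src0 e.1).2).
Definition tgt (e : edge) : vertex := ((tgt0 e.1).1, e.2 + (tgt0 e.1).2).

(* Each class of edges contains exactly one edge starting at a vertex of the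
   class where it starts, and likewise for the ends. *)
Definition edge_from (v : vertex) (j : 'I_6) : edge := (j, v.2 - (src0 j).2).
Definition edge_to (v : vertex) (j : 'I_6) : edge := (j, v.2 - (tgt0 j).2).

Section Graph.
Context {R : realType}.
Local Notation C := R[i].

(* A function on the periodic graph: y e x is its value at the point of e with
   parameter x in [0, a]; values for other x are irrelevant. *)
Definition graph_fun : Type := edge -> R -> C.

Definition continuous_at_vertices (a : R) (y : graph_fun) : Prop :=
  exists u : vertex -> C,
    forall e : edge, y e 0 = u (src e) /\ y e a = u (tgt e).

Definition kirchhoff (a : R) (dy : graph_fun) : Prop :=
  forall v : vertex,
    \sum_(j | (src0 j).1 == v.1) dy (edge_from v j) 0
    - \sum_(j | (tgt0 j).1 == v.1) dy (edge_to v j) a = 0.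

Definition quasi_periodic (a theta1 theta2 : R) (y : graph_fun) : Prop :=
  forall (j : 'I_6) (n p : cell) (x : R), 0 <= x <= a ->
    y (j, n + p) x =
    expi (p.1%:~R * theta1 + p.2%:~R * theta2) * y (j, n) x.

Definition bloch_L2 (a theta1 theta2 : R) (f : graph_fun) : Prop :=
  quasi_periodic a theta1 theta2 f /\ forall j : 'I_6, isL2 a (f (j, 0)).

Definition bloch_normsq (a : R) (f : graph_fun) : \bar R :=
  (\sum_(j < 6) L2sq a (f (j, 0%R)))%E.

(* The graph of the operator H^Theta: y is in its domain and H^Theta y = g. *)
Definition bloch_hamiltonian (a : R) (q : 'I_6 -> R -> R) (theta1 theta2 : R)
    (y g : graph_fun) : Prop :=
  exists dy : graph_fun,
    [/\ forall e : edge, sturm_liouville a (q e.1) (y e) (dy e) (g e),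
        continuous_at_vertices a y,
        kirchhoff a dy,
        quasi_periodic a theta1 theta2 y &
        bloch_L2 a theta1 theta2 g].

(* H^Theta - z maps its domain bijectively onto L^2, with bounded inverse. *)
Definition bloch_resolvent_set (a : R) (q : 'I_6 -> R -> R)
    (theta1 theta2 : R) : set C :=
  [set z | exists M : R, forall f : graph_fun, bloch_L2 a theta1 theta2 f ->
     let solves y := bloch_hamiltonian a q theta1 theta2 y
                       (fun e x => z * y e x + f e x) in
     exists y : graph_fun,
       [/\ solves y,
           (bloch_normsq a y <= M%:E * bloch_normsq a f)%E &
           forall y1 : graph_fun, solves y1 ->
             forall e x, 0 <= x <= a -> y1 e x = y e x]].

Definition bloch_spectrum (a : R) (q : 'I_6 -> R -> R) (theta1 theta2 : R) :
    set C :=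
  ~` bloch_resolvent_set a q theta1 theta2.

End Graph.

(* The k-th member of a family over 'I_6, counting from 1. *)
Notation "f .{ k }" := (f (@inord 5 (predn k%N)))
  (at level 1, left associativity, format "f .{ k }") : ring_scope.

(* Below, c, c', s, s' stand for the values at x = a of C, C', S, S'. *)
Section CharacteristicFunction.
Context {K : comNzRingType}.

Definition bloch_forms (c c' s s' : 'I_6 -> K) (alpha beta : K)
    (A B : 'I_6 -> K) : seq K :=
  [:: A.{1} - A.{3};
      A.{1} - A.{4};
      A.{1} - A.{6};
      B.{1} + B.{3} + B.{4} + B.{6};
      c.{2} * A.{2} - c.{3} * A.{3} + s.{2} * B.{2} - s.{3} * B.{3};
      c.{2} * A.{2} - alpha * c.{4} * A.{4}
        + s.{2} * B.{2} - alpha * s.{4} * B.{4};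
      c.{2} * A.{2} - alpha * c.{5} * A.{5}
        + s.{2} * B.{2} - alpha * s.{5} * B.{5};
      c'.{2} * A.{2} + c'.{3} * A.{3}
        + alpha * c'.{4} * A.{4} + alpha * c'.{5} * A.{5}
        + s'.{2} * B.{2} + s'.{3} * B.{3}
        + alpha * s'.{4} * B.{4} + alpha * s'.{5} * B.{5};
      A.{2} - beta * A.{5};
      A.{2} - beta * c.{6} * A.{6} - beta * s.{6} * B.{6};
      - (c.{1} * A.{1}) + A.{2} - s.{1} * B.{1};
      c'.{1} * A.{1} + beta * c'.{6} * A.{6} + s'.{1} * B.{1}
        - B.{2} - beta * B.{5} + beta * s'.{6} * B.{6}].

(* Column k holds the coefficients of the k-th unknown among A.{1}, ..., A.{6},
   B.{1}, ..., B.{6}: the values of the forms at that unit vector. *)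
Definition bloch_matrix (c c' s s' : 'I_6 -> K) (alpha beta : K) : 'M[K]_12 :=
  \matrix_(i, k) (bloch_forms c c' s s' alpha beta
                    (fun j => (k == j :> nat)%:R)
                    (fun j => (k == 6 + j :> nat)%N%:R))`_i.

Definition bloch_charfun (c c' s s' : 'I_6 -> K) (alpha beta : K) : K :=
  \det (bloch_matrix c c' s s' alpha beta).

Definition CS (c s : 'I_6 -> K) (i j : nat) : K :=
  c.{i} * s.{j} + c.{j} * s.{i}.

Definition CS' (c c' s s' : 'I_6 -> K) (i j : nat) : K :=
  c'.{i} * s.{j} + c.{i} * s'.{j} + c'.{j} * s.{i} + c.{j} * s'.{i}.

Definition CSSS (c s : 'I_6 -> K) (i j k l : nat) : K :=
  c.{i} * s.{j} * s.{k} * s.{l} + c.{j} * s.{i} * s.{k} * s.{l}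
  + c.{k} * s.{i} * s.{j} * s.{l} + c.{l} * s.{i} * s.{j} * s.{k}.

Definition SS' (s s' : 'I_6 -> K) (i j : nat) : K :=
  s'.{i} * s.{j} + s.{i} * s'.{j}.

Definition SSSS' (s s' : 'I_6 -> K) (i j k l : nat) : K :=
  s'.{i} * s.{j} * s.{k} * s.{l} + s.{i} * s'.{j} * s.{k} * s.{l}
  + s.{i} * s.{j} * s'.{k} * s.{l} + s.{i} * s.{j} * s.{k} * s'.{l}.

End CharacteristicFunction.

(* Main.v *)
Require Import Defs.
From HB Require Import structures.
From mathcomp Require Import all_boot all_order all_algebra.
From mathcomp Require Import complex.
From mathcomp Require Import all_classical all_reals all_analysis.
From mathcomp Require Import measurable_realfun.
From mathcomp Require Import ring lra zify.

(* The spectral part is a reduction to linear algebra. For primitives F, G of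
   summable functions, the increment of F G - int (F' G + F G') over [x, y] is
   at most the square of the increment of V = int (|F'| + |G'|); halving [x, y]
   repeatedly so that V splits evenly forces it to vanish, which is the product
   rule. Hence Wronskians have the expected derivatives, C S' - C' S = 1, and
   every solution of - y'' + q y = lambda y + f is given by variation of
   constants from (A, B) = (y(0), y'(0)). Quasi-periodicity reduces the
   continuity and Kirchhoff conditions to twelve equations M X + r = 0, where M
   is the characteristic matrix, X collects the A_j and B_j, and r depends
   linearly on f, with a bound by its L^1 norm, hence by its L^2 norm. If
   det M <> 0, then X = - M^-1 r gives the unique solution and the bound on the
   resolvent. If det M = 0, then a kernel vector gives a nonzero solution for
   f = 0. *)

Set Implicit Arguments.
Unset Strict Implicit.

Import Order.TTheory GRing.Theory Num.Theory.
Import numFieldNormedType.Exports.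

Local Open Scope ring_scope.
Local Open Scope complex_scope.
Local Open Scope classical_set_scope.

(** * The characteristic determinant *)

Section Laplace.
Context {K : comNzRingType}.
Implicit Types (r : seq (option K)) (M : seq (seq (option K))).

Definition skip_nth i r := take i r ++ drop i.+1 r.

(* None is a syntactic zero: evaluating the expansion never visits the minors of
   zero entries, so only the nonzero terms of the determinant are produced. *)
Definition row_expansion n r (minor : nat -> K) : K :=
  foldr (fun j acc => if nth None r j is Some x
    then (if odd j then - (x * minor j) else x * minor j) + acc else acc)
    0 (iota 0 n).

Fixpoint laplace n M : K :=
  if n is m.+1 then
    row_expansion n (head [::] M)
      (fun j => laplace m (map (skip_nth j) (behead M)))
  else 1.

Definition table_mx n M : 'M[K]_n :=
  \matrix_(i, j) odflt 0 (nth None (nth [::] M i) j).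

(** The index map [bump] underlies [lift], by which cofactors delete a column, so deleting a list
    entry agrees with deleting a matrix column. *)
Lemma nth_skip_nth i r k : nth None (skip_nth i r) k = nth None r (bump i k).
Proof.
rewrite /skip_nth nth_cat size_take_min /bump.
case: (leqP i k) => ik.
  rewrite add1n ltnNge geq_min ik /= nth_drop.
  case: (leqP i (size r)) => ir; first by congr (nth _ _ _); lia.
  rewrite !nth_default //; lia.
rewrite add0n leq_min ik /= ltnNge.
case: (leqP (size r) k) => kr /=; last by rewrite nth_take.
by rewrite drop_oversize ?nth_nil ?nth_default //; lia.
Qed.

Lemma row_expansionE n r (minor : nat -> K) :
  row_expansion n r minor =
  \sum_(j < n) odflt 0 (nth None r j) * ((-1) ^+ j * minor j).
Proof.
rewrite -(big_mkord xpredT (fun j =>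
  odflt 0 (nth None r j) * ((-1) ^+ j * minor j))).
rewrite /row_expansion /index_iota subn0; elim: (iota 0 n) => [|j t IH].
  by rewrite big_nil.
rewrite big_cons -IH /= -signr_odd.
case: (nth None r j) => [x|] /=; last by rewrite mul0r add0r.
by case: (odd j); rewrite ?expr1 ?expr0 ?mulN1r ?mul1r ?mulrN.
Qed.

Lemma laplaceS n M : laplace n.+1 M =
  row_expansion n.+1 (head [::] M)
    (fun j => laplace n (map (skip_nth j) (behead M))).
Proof. by []. Qed.

(** Expansion along the first row: [behead] and [skip_nth j] mirror the deletions by [lift ord0] and
    [lift j] in the cofactor. *)
Lemma det_table_mx n M : \det (table_mx n M) = laplace n M.
Proof.
elim: n M => [|n IH] M; first by rewrite det_mx00.
rewrite (expand_det_row _ ord0) laplaceS row_expansionE; apply: eq_bigr => j _.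
rewrite mxE nth0 /cofactor add0n /= -IH.
congr (_ * (_ * \det _)); apply/matrixP => k l; rewrite !mxE /=.
rewrite -nth_skip_nth; congr (odflt _ (nth _ _ _)).
rewrite /bump leq0n add1n -nth_behead.
case: (ltnP k (size (behead M))) => kM; first by rewrite (nth_map [::]).
by rewrite !nth_default ?size_map.
Qed.

End Laplace.

(** * Evaluation of the twelve-by-twelve determinant *)

Section CharacteristicDeterminant.
Context {K : comNzRingType}.
Variables (c c' s s' : 'I_6 -> K) (al be : K).

Definition bloch_table : seq (seq (option K)) :=
  let o := @None K in let i := Some (1 : K) in
  [:: [:: i; o; Some (-1); o; o; o; o; o; o; o; o; o];
      [:: i; o; o; Some (-1); o; o; o; o; o; o; o; o];
      [:: i; o; o; o; o; Some (-1); o; o; o; o; o; o];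
      [:: o; o; o; o; o; o; i; o; i; i; o; i];
      [:: o; Some c.{2}; Some (- c.{3}); o; o; o;
          o; Some s.{2}; Some (- s.{3}); o; o; o];
      [:: o; Some c.{2}; o; Some (- (al * c.{4})); o; o;
          o; Some s.{2}; o; Some (- (al * s.{4})); o; o];
      [:: o; Some c.{2}; o; o; Some (- (al * c.{5})); o;
          o; Some s.{2}; o; o; Some (- (al * s.{5})); o];
      [:: o; Some c'.{2}; Some c'.{3}; Some (al * c'.{4}); Some (al * c'.{5}); o;
          o; Some s'.{2}; Some s'.{3}; Some (al * s'.{4}); Some (al * s'.{5}); o];
      [:: o; i; o; o; Some (- be); o; o; o; o; o; o; o];
      [:: o; i; o; o; o; Some (- (be * c.{6})); o; o; o; o; o;
        Some (- (be * s.{6}))];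
      [:: Some (- c.{1}); i; o; o; o; o; Some (- s.{1}); o; o; o; o; o];
      [:: Some c'.{1}; o; o; o; o; Some (be * c'.{6});
          Some s'.{1}; Some (-1); o; o; Some (- be); Some (be * s'.{6})]].

Lemma bloch_matrixE : bloch_matrix c c' s s' al be = table_mx 12 bloch_table.
Proof.
apply/matrixP => i k; rewrite !mxE /bloch_forms.
case: i => [[|[|[|[|[|[|[|[|[|[|[|[|i]]]]]]]]]]]] lti] //=;
  rewrite ?inordK // {lti};
case: k => [[|[|[|[|[|[|[|[|[|[|[|[|k]]]]]]]]]]]] ltk] //=;
by rewrite ?(mulr1, mulr0, addr0, subr0, add0r, sub0r, oppr0, mulrN).
Qed.

Hypothesis wronskian : forall j, c j * s' j - c' j * s j = 1.

(** The inverse phases enter only as [al'] and [be'], so that the claim is a polynomial identity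
    modulo [al * al' = 1], [be * be' = 1] and the six Wronskian relations. *)
Lemma bloch_charfunE (al' be' : K) : al * al' = 1 -> be * be' = 1 ->
  bloch_charfun c c' s s' al be = - (al ^+ 2 * be ^+ 2) *
    ((s.{1} * s.{2} * s.{4} + s.{3} * s.{5} * s.{6}) * (al + al')
     + (s.{1} * s.{3} * s.{5} + s.{2} * s.{4} * s.{6}) * (al * be' + al' * be)
     + (s.{1} * s.{4} * s.{5} + s.{2} * s.{3} * s.{6}) * (be + be')
     + 2 * (s.{1} * s.{2} * s.{3} + s.{4} * s.{5} * s.{6})
     + SSSS' s s' 2 3 4 5 * (be + be' - CS' c c' s s' 1 6)
     + CSSS c s 1 3 4 6 * (al * be' + al' * be - CS' c c' s s' 2 5)
     - SS' s s' 1 6 * SS' s s' 2 5 * CS c s 3 4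
     - SS' s s' 3 4 * CS c s 2 5 * CS c s 1 6
     + (s.{1} * s.{6} * CS c s 2 5 + s.{2} * s.{5} * SS' s s' 1 6)
       * (al + al' - CS' c c' s s' 3 4)).
Proof.
move=> ala bebe.
(* Each Wronskian relation is oriented with a single monomial on the left, the shape of a rewriting
   rule that [ring] accepts as a hypothesis. *)
have w j : c j * s' j = 1 + c' j * s j by rewrite -(wronskian j); ring.
rewrite /bloch_charfun bloch_matrixE det_table_mx.
(* Only the list recursion is unfolded; the ring operations stay folded, which leaves the sparse
   expansion as a plain polynomial expression. *)
cbv [laplace bloch_table row_expansion iota foldr nth skip_nth take drop cat
  map head behead odd negb].
rewrite /CS' /SSSS' /CSSS /SS' /CS.
move: (w (inord 0)) (w (inord 1)) (w (inord 2)) (w (inord 3)) (w (inord 4))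
  (w (inord 5)).
rewrite /predn.
(* The 24 boundary values become variables, hence atoms for [ring]. *)
move: (c (inord 0)) (c (inord 1)) (c (inord 2)) (c (inord 3)) (c (inord 4))
  (c (inord 5)).
move: (c' (inord 0)) (c' (inord 1)) (c' (inord 2)) (c' (inord 3))
  (c' (inord 4)) (c' (inord 5)).
move: (s (inord 0)) (s (inord 1)) (s (inord 2)) (s (inord 3)) (s (inord 4))
  (s (inord 5)).
move: (s' (inord 0)) (s' (inord 1)) (s' (inord 2)) (s' (inord 3))
  (s' (inord 4)) (s' (inord 5)).
move=> t1 t2 t3 t4 t5 t6 s1 s2 s3 s4 s5 s6 d1 d2 d3 d4 d5 d6 c1 c2 c3 c4 c5 c6.
move=> w1 w2 w3 w4 w5 w6.
ring: w1 w2 w3 w4 w5 w6 ala bebe.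
Qed.

End CharacteristicDeterminant.

(** * Primitives of real summable functions *)

Section RealPrimitive.
Context {R : realType}.
Local Notation mu := (@lebesgue_measure R).
Implicit Types (f g F G : R -> R) (a b x y : R).

Definition summable_on a f := mu.-integrable `[0, a] (EFin \o f).
Definition int0 f x : R := (\int[mu]_(t in `[0, x]) f t)%R.

Lemma summable_onS {a f} x : x <= a -> summable_on a f -> summable_on x f.
Proof.
move=> xa; apply: integrableS => //; apply: subset_itvl.
by rewrite bnd_simp.
Qed.

Lemma summable_onD a f g : summable_on a f -> summable_on a g ->
  summable_on a (fun t => f t + g t).
Proof. by move=> fi gi; apply: eq_integrable (integrableD _ fi gi). Qed.

Lemma summable_onZ a k f : summable_on a f -> summable_on a (fun t => k * f t).
Proof. by move=> fi; apply: eq_integrable (integrableZl _ k fi). Qed.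

Lemma summable_onB a f g : summable_on a f -> summable_on a g ->
  summable_on a (fun t => f t - g t).
Proof. by move=> fi gi; apply: eq_integrable (integrableB _ fi gi). Qed.

Lemma summable_on_norm a f : summable_on a f -> summable_on a (fun t => `|f t|).
Proof. exact: integrable_norm. Qed.

Lemma summable_onM a (h f : R -> R) : {within `[0, a], continuous h} ->
  summable_on a f -> summable_on a (fun t => h t * f t).
Proof.
move=> hc fi; apply: eq_integrable (integrableMr _ _ _ fi) => //.
  by apply: subspace_continuous_measurable_fun.
have /compact_bounded[M [_ mrt]] := continuous_compact hc (@segment_compact _ 0 a).
by exists M; split; rewrite ?num_real // => ? ? ? ?; exact: mrt.
Qed.

Lemma int0_continuous a f : 0 <= a -> summable_on a f ->
  {within `[0, a], continuous (int0 f)}.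
Proof. exact: parameterized_integral_continuous. Qed.

Lemma int0_0 f : int0 f 0 = 0.
Proof. by rewrite /int0 set_itv1 Rintegral_set1. Qed.

Lemma int0D a f g x : x <= a -> summable_on a f -> summable_on a g ->
  int0 (fun t => f t + g t) x = int0 f x + int0 g x.
Proof. by move=> xa /(summable_onS xa) fi /(summable_onS xa) gi;
  exact: RintegralD. Qed.

Lemma int0B a f g x : x <= a -> summable_on a f -> summable_on a g ->
  int0 (fun t => f t - g t) x = int0 f x - int0 g x.
Proof. by move=> xa /(summable_onS xa) fi /(summable_onS xa) gi;
  exact: RintegralB. Qed.

Lemma int0Z a k f x : x <= a -> summable_on a f ->
  int0 (fun t => k * f t) x = k * int0 f x.
Proof. by move=> xa /(summable_onS xa) fi; exact: RintegralZl. Qed.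

Lemma eq_int0 f g x : (forall t, 0 <= t <= x -> f t = g t) -> int0 f x = int0 g x.
Proof.
by move=> fg; apply: eq_Rintegral => t; rewrite inE /= in_itv /=; exact: fg.
Qed.

Lemma eq_summable_on a f g : (forall t, 0 <= t <= a -> f t = g t) ->
  summable_on a f -> summable_on a g.
Proof.
move=> fg; apply: eq_integrable => // t; rewrite inE /= in_itv /= => ta.
by rewrite /= fg.
Qed.

Lemma int0_ge0 f x : (forall t, 0 <= t <= x -> 0 <= f t) -> 0 <= int0 f x.
Proof. by move=> f0; apply: Rintegral_ge0 => t /=; rewrite in_itv; exact: f0. Qed.

Lemma le_int0 a f g x : x <= a -> summable_on a f -> summable_on a g ->
  (forall t, 0 <= t <= x -> f t <= g t) -> int0 f x <= int0 g x.
Proof.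
move=> xa /(summable_onS xa) fi /(summable_onS xa) gi fg.
by apply: le_Rintegral => // t /=; rewrite in_itv; exact: fg.
Qed.

Lemma le_norm_int0 a f x : x <= a -> summable_on a f ->
  `|int0 f x| <= int0 (fun t => `|f t|) x.
Proof. by move=> xa /(summable_onS xa) fi; exact: le_normr_Rintegral. Qed.

Lemma int0_itv a f x y : 0 <= x -> x <= y -> y <= a -> summable_on a f ->
  int0 f y - int0 f x = (\int[mu]_(t in `]x, y]) f t)%R.
Proof.
move=> x0 xy ya /(summable_onS ya) fi.
by apply: Rintegral_itvB => //; rewrite bnd_simp.
Qed.

Lemma le_int0_incr a f g x y : 0 <= x -> x <= y -> y <= a ->
  summable_on a f -> summable_on a g ->
  (forall t, x <= t <= y -> `|f t| <= g t) ->
  `|int0 f y - int0 f x| <= int0 g y - int0 g x.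
Proof.
move=> x0 xy ya fi gi fg; rewrite !(int0_itv (a := a)) //.
have sub : `]x, y] `<=` `[0, a].
  by apply: subset_itv; rewrite bnd_simp.
have fi' : mu.-integrable `]x, y] (EFin \o f) by apply: integrableS fi.
have gi' : mu.-integrable `]x, y] (EFin \o g) by apply: integrableS gi.
apply: le_trans (le_normr_Rintegral _ fi') _ => //.
apply: le_Rintegral => //; first exact: integrable_norm.
by move=> t /=; rewrite in_itv /= => /andP[/ltW xt ty]; rewrite fg ?xt.
Qed.

(* Halving [x, y] so that V splits evenly halves the quadratic bound. *)
Lemma constant_of_quadratic_increments a (K V : R -> R) : 0 <= a ->
  {within `[0, a], continuous V} ->
  (forall x y, 0 <= x -> x <= y -> y <= a ->
    V x <= V y /\ `|K y - K x| <= (V y - V x) ^+ 2) ->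
  forall x, 0 <= x <= a -> K x = K 0.
Proof.
move=> a0 Vc Kq.
have Kn n : forall x y, 0 <= x -> x <= y -> y <= a ->
    `|K y - K x| <= (V y - V x) ^+ 2 / 2 ^+ n.
  elim: n => [|n IH] x y x0 xy ya; first by rewrite divr1; apply: (Kq x y _ _ _).2.
  have [Vxy _] := Kq _ _ x0 xy ya.
  have Vc' : {within `[x, y], continuous V}.
    apply: continuous_subspaceW Vc; apply: subset_itv; rewrite bnd_simp //.
  (* The point [m] is where [V] takes the mean of its values at [x] and [y]. *)
  have [|m] := @IVT R V x y ((V x + V y) / 2) xy Vc'.
    rewrite min_l // max_r //; apply/andP; split; lra.
  rewrite in_itv /= => /andP[xm my] Vm.
  have := IH _ _ x0 xm (le_trans my ya).
  have := IH _ _ (le_trans x0 xm) my ya.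
  have -> : V y - V m = (V y - V x) / 2 by rewrite Vm; field.
  have -> : V m - V x = (V y - V x) / 2 by rewrite Vm; field.
  (* Two squares of half the increment add up to half of its square: each halving gains a factor
     2. *)
  have -> : (V y - V x) ^+ 2 / 2 ^+ n.+1 =
    ((V y - V x) / 2) ^+ 2 / 2 ^+ n + ((V y - V x) / 2) ^+ 2 / 2 ^+ n.
    have p0 : (2 : R) ^+ n != 0 by rewrite expf_neq0.
    by rewrite (exprS (2 : R) n); move: (2 ^+ n) p0 => p p0; field.
  move=> h1 h2; have -> : K y - K x = (K y - K m) + (K m - K x) by ring.
  by apply: le_trans (ler_normD _ _) _; apply: lerD.
move=> x /andP[x0 xa]; apply/eqP; rewrite -subr_eq0 -normr_eq0; apply/eqP.
apply/le_anti; rewrite normr_ge0 andbT; apply/ler_addgt0Pr => e e0; rewrite add0r.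
set v := (V x - V 0) ^+ 2.
have v0 : 0 <= v by rewrite /v sqr_ge0.
have [n vn] : exists n : nat, v / e <= 2 ^+ n.
  exists (Num.truncn (v / e)).+1; apply: le_trans (ltW (truncnS_gt _)) _.
  by rewrite -natrX ler_nat ltnW // ltn_expl.
apply: le_trans (Kn n _ _ (lexx 0) x0 xa) _.
rewrite -/v ler_pdivrMr ?exprn_gt0 // mulrC -ler_pdivrMr //.
Qed.

Definition primitive_on a F f :=
  summable_on a f /\ forall x, 0 <= x <= a -> F x = F 0 + int0 f x.

Lemma primitive_on_continuous a F f : 0 <= a -> primitive_on a F f ->
  {within `[0, a], continuous F}.
Proof.
move=> a0 [fi Ff].
have /subspace_eq_continuous h : {in `[0, a], (fun x => F 0 + int0 f x) =1 F}.
  by move=> x; rewrite inE /= in_itv /= => xa; rewrite [RHS]Ff.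
apply: h => x; apply: cvgD; first exact: cvg_cst.
exact: int0_continuous.
Qed.

(** Integration by parts for absolutely continuous functions with merely summable derivatives; the
    defect [K] of the rule is shown to be constant. *)
Lemma primitive_onM a F G f g : 0 <= a ->
  primitive_on a F f -> primitive_on a G g ->
  primitive_on a (fun t => F t * G t) (fun t => f t * G t + F t * g t).
Proof.
move=> a0 Ff Gg.
have Fc := primitive_on_continuous a0 Ff.
have Gc := primitive_on_continuous a0 Gg.
case: Ff Gg => fi Ff [gi Gg].
have Gfi : summable_on a (fun t => G t * f t) by apply: summable_onM.
have Fgi : summable_on a (fun t => F t * g t) by apply: summable_onM.
have fGi : summable_on a (fun t => f t * G t).
  by apply: eq_summable_on Gfi => t _; rewrite mulrC.
split; first exact: summable_onD.
pose V x := int0 (fun t => `|f t| + `|g t|) x.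
pose K x := F x * G x - int0 (fun t => f t * G t + F t * g t) x.
have Vi : summable_on a (fun t => `|f t| + `|g t|).
  by apply: summable_onD; apply: summable_on_norm.
suff KK z : 0 <= z <= a -> K z = K 0.
  by move=> x xa; move/eqP: (KK x xa);
    rewrite /K int0_0 subr0 subr_eq addrC => /eqP ->; rewrite addrC.
apply: (@constant_of_quadratic_increments a K V) => //;
  first exact: int0_continuous.
(* Stated for a generic [H], this serves both [F] and [G]: the increments of each are dominated by
   those of [V]. *)
have dF h H u v : summable_on a h -> (forall x,
  0 <= x <= a -> H x = H 0 + int0 h x) ->
    (forall t, `|h t| <= `|f t| + `|g t|) ->
    0 <= u -> u <= v -> v <= a -> `|H v - H u| <= V v - V u.
  move=> hi Hh hle u0 uv va.
  rewrite (Hh v) ?(Hh u) ?va ?(le_trans uv va) ?u0 ?(le_trans u0 uv) //.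
  have -> : H 0 + int0 h v - (H 0 + int0 h u) = int0 h v - int0 h u by ring.
  exact: (le_int0_incr (a := a)).
have Vmono u v : 0 <= u -> u <= v -> v <= a -> V u <= V v.
  move=> u0 uv va; rewrite -subr_ge0 (le_trans (normr_ge0 (F v - F u))) //.
  by apply: (dF f) => // t; rewrite lerDl.
move=> x y x0 xy ya; split; first exact: Vmono.
set D := V y - V x.
(* Since F(y)G(y) - F(x)G(x) = G(y)(F(y) - F(x)) + F(x)(G(y) - G(x)), freezing [G] at the right end
   and [F] at the left end is exact, and [h] integrates over [x, y] to the increment of [K]. *)
pose h t := (G y * f t + F x * g t) - (f t * G t + F t * g t).
have pi : summable_on a (fun t => f t * G t + F t * g t) by apply: summable_onD.
have qi : summable_on a (fun t => G y * f t + F x * g t).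
  by apply: summable_onD; apply: summable_onZ.
have -> : K y - K x = int0 h y - int0 h x.
  have hE u : u <= a -> int0 h u = G y * int0 f u + F x * int0 g u -
      int0 (fun t => f t * G t + F t * g t) u.
    move=> ua; rewrite (int0B ua qi pi) (int0D ua) ?(int0Z _ ua) //;
      exact: summable_onZ.
  have xa := le_trans xy ya; rewrite !hE // /K.
  have := Ff y; have := Ff x; have := Gg y; have := Gg x.
  rewrite x0 xa (le_trans x0 xy) ya.
  move=> /(_ isT) -> /(_ isT) -> /(_ isT) -> /(_ isT) ->; ring.
have -> : D ^+ 2 = int0 (fun t => D * (`|f t| + `|g t|)) y -
                   int0 (fun t => D * (`|f t| + `|g t|)) x.
  by rewrite !(int0Z _ _ Vi) ?(le_trans xy ya) // -/(V y) -/(V x) /D; ring.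
apply: (le_int0_incr (a := a)) => //; first exact: summable_onB.
  exact: summable_onZ.
move=> t /andP[xt ty].
(* The factors of [f t] and [g t] are increments inside [x, y], hence at most [D] in absolute value;
   integrating D(|f| + |g|) then yields the second factor [D]. *)
have -> : h t = (G y - G t) * f t + - (F t - F x) * g t by rewrite /h; ring.
apply: le_trans (ler_normD _ _) _; rewrite !normrM normrN mulrDr.
have := Vmono x t x0 xt (le_trans ty ya); have := Vmono t y (le_trans x0 xt) ty ya.
move=> Vty Vxt.
apply: lerD; apply: ler_wpM2r => //.
  apply: (@le_trans _ _ (V y - V t)); last by rewrite /D; lra.
  by apply: (dF g) => //; [move=> u; rewrite lerDr | exact: le_trans xt].
apply: (@le_trans _ _ (V t - V x)); last by rewrite /D; lra.
by apply: (dF f) => //; [move=> u; rewrite lerDl | exact: le_trans ya].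
Qed.


End RealPrimitive.

(** * Primitives of complex functions *)

Section ComplexParts.
Context {R : realType}.
Local Notation Re := (@complex.Re R).
Local Notation Im := (@complex.Im R).
Implicit Types u v : R[i].

Lemma ReD u v : Re (u + v) = Re u + Re v. Proof. by case: u v => [? ?] []. Qed.
Lemma ImD u v : Im (u + v) = Im u + Im v. Proof. by case: u v => [? ?] []. Qed.
Lemma ReN u : Re (- u) = - Re u. Proof. by case: u. Qed.
Lemma ImN u : Im (- u) = - Im u. Proof. by case: u. Qed.
Lemma ReM u v : Re (u * v) = Re u * Re v - Im u * Im v.
Proof. by case: u v => [? ?] []. Qed.
Lemma ImM u v : Im (u * v) = Re u * Im v + Im u * Re v.
Proof. by case: u v => [? ?] []. Qed.
Definition ReImE := (ReD, ImD, ReN, ImN, ReM, ImM).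

Lemma complex_ext u v : Re u = Re v -> Im u = Im v -> u = v.
Proof. by case: u v => [? ?] [? ?] /= -> ->. Qed.

(* Unlike the modulus, the l^1 norm on R^2 takes values in R, and it is still
   submultiplicative. *)
Definition taxi u : R := `|Re u| + `|Im u|.

Lemma taxi_ge0 u : 0 <= taxi u. Proof. by rewrite addr_ge0. Qed.

Lemma taxi0 : taxi 0 = 0. Proof. by rewrite /taxi /= normr0 addr0. Qed.

Lemma taxiN u : taxi (- u) = taxi u.
Proof. by rewrite /taxi !ReImE !normrN. Qed.

Lemma taxiD u v : taxi (u + v) <= taxi u + taxi v.
Proof.
rewrite /taxi !ReImE; have := ler_normD (Re u) (Re v);
  have := ler_normD (Im u) (Im v).
lra.
Qed.

Lemma taxiM u v : taxi (u * v) <= taxi u * taxi v.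
Proof.
rewrite /taxi !ReImE; have := ler_normB (Re u * Re v) (Im u * Im v).
have := ler_normD (Re u * Im v) (Im u * Re v); rewrite !normrM; lra.
Qed.

Lemma sqr_le_taxi u : Re u ^+ 2 + Im u ^+ 2 <= taxi u ^+ 2.
Proof.
rewrite -(real_normK (num_real (Re u))) -(real_normK (num_real (Im u))) /taxi.
have := mulr_ge0 (normr_ge0 (Re u)) (normr_ge0 (Im u)); nra.
Qed.

Lemma taxi_le_sqr u : taxi u ^+ 2 <= 2 * (Re u ^+ 2 + Im u ^+ 2).
Proof.
rewrite -(real_normK (num_real (Re u))) -(real_normK (num_real (Im u))) /taxi.
have := sqr_ge0 (`|Re u| - `|Im u|); nra.
Qed.

End ComplexParts.

Section ComplexPrimitive.
Context {R : realType}.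
Local Notation mu := (@lebesgue_measure R).
Local Notation Re := (@complex.Re R).
Local Notation Im := (@complex.Im R).
Implicit Types (f g F G : R -> R[i]) (a x : R).

(** Brings the complex notion back to two real ones, through which continuity and the product rule
    are transferred. *)
Lemma ac_primitiveE a F f : ac_primitive a F f <->
  primitive_on a (fun t => Re (F t)) (fun t => Re (f t)) /\
  primitive_on a (fun t => Im (F t)) (fun t => Im (f t)).
Proof.
split=> [[[fr fi] Ff]|[[fr Fr] [fi Fi]]].
  by split; split=> // x xa; rewrite Ff // ReImE.
by split=> // x xa; apply: complex_ext; rewrite ReImE; [exact: Fr|exact: Fi].
Qed.

Lemma eq_cintegrable a f g : (forall t, 0 <= t <= a -> f t = g t) ->
  cintegrable `[0, a] f -> cintegrable `[0, a] g.
Proof.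
move=> fg [fr fi]; split.
  by apply: (@eq_summable_on _ _ (fun t => Re (f t))) => // t /fg ->.
by apply: (@eq_summable_on _ _ (fun t => Im (f t))) => // t /fg ->.
Qed.

Lemma eq_cintegral x f g : (forall t, 0 <= t <= x -> f t = g t) ->
  cintegral `[0, x] f = cintegral `[0, x] g.
Proof.
move=> fg; congr (_ +i* _).
  by apply: (@eq_int0 _ (fun t => Re (f t))) => t /fg ->.
by apply: (@eq_int0 _ (fun t => Im (f t))) => t /fg ->.
Qed.

Lemma eq_ac_primitive a F G f g :
  (forall t, 0 <= t <= a -> F t = G t) -> (forall t, 0 <= t <= a -> f t = g t) ->
  0 <= a -> ac_primitive a F f -> ac_primitive a G g.
Proof.
move=> FG fg a0 [fi Ff]; split; first exact: eq_cintegrable fi.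
move=> x /andP[x0 xa]; rewrite -!FG ?lexx ?x0 ?xa // (Ff x) ?x0 ?xa //;
  congr (_ + _).
by apply: eq_cintegral => t /andP[t0 tx]; rewrite fg // t0 (le_trans tx).
Qed.

Lemma ac_primitive_continuous a F f : 0 <= a -> ac_primitive a F f ->
  {within `[0, a], continuous (fun t => Re (F t))} /\
  {within `[0, a], continuous (fun t => Im (F t))}.
Proof.
by move=> a0 /ac_primitiveE[Fr Fi]; split; apply: primitive_on_continuous a0 _;
  eassumption.
Qed.

Lemma cintegrableMl a F f g : 0 <= a -> ac_primitive a F f ->
  cintegrable `[0, a] g -> cintegrable `[0, a] (fun t => F t * g t).
Proof.
move=> a0 /(ac_primitive_continuous a0)[Fr Fi] [gr gi]; split.
  apply: eq_summable_on (summable_onB (summable_onM Fr gr) (summable_onM Fi gi)).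
  by move=> t _; rewrite ReImE.
apply: eq_summable_on (summable_onD (summable_onM Fr gi) (summable_onM Fi gr)).
by move=> t _; rewrite ReImE.
Qed.

Lemma ac_primitive_cst a (k : R[i]) : 0 <= a -> ac_primitive a (fun=> k) (fun=> 0).
Proof.
move=> a0.
have s0 : summable_on a (fun=> 0) by exact: integrable0.
have i0 x : int0 (fun=> 0 : R) x = 0 by rewrite /int0 Rintegral_cst // mul0r.
by apply/ac_primitiveE; split; split=> // x _; rewrite i0 addr0.
Qed.

Lemma primitive_onD a (F G f g : R -> R) : primitive_on a F f -> primitive_on a
  G g ->
  primitive_on a (fun t => F t + G t) (fun t => f t + g t).
Proof.
move=> [fi Ff] [gi Gg]; split; first exact: summable_onD.
move=> x xa; rewrite Ff // Gg // (int0D _ fi gi); first by ring.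
by case/andP: xa.
Qed.

Lemma primitive_onB a (F G f g : R -> R) : primitive_on a F f -> primitive_on a
  G g ->
  primitive_on a (fun t => F t - G t) (fun t => f t - g t).
Proof.
move=> [fi Ff] [gi Gg]; split; first exact: summable_onB.
move=> x xa; rewrite Ff // Gg // (int0B _ fi gi); first by ring.
by case/andP: xa.
Qed.

Lemma eq_primitive_on a (F G f g : R -> R) : F =1 G -> f =1 g ->
  primitive_on a F f -> primitive_on a G g.
Proof. by move=> /funext -> /funext ->. Qed.

Lemma ac_primitiveD a F G f g : ac_primitive a F f -> ac_primitive a G g ->
  ac_primitive a (fun t => F t + G t) (fun t => f t + g t).
Proof.
move=> /ac_primitiveE[Fr Fi] /ac_primitiveE[Gr Gi]; apply/ac_primitiveE; split.
  by apply: eq_primitive_on (primitive_onD Fr Gr) => t; rewrite ReImE.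
by apply: eq_primitive_on (primitive_onD Fi Gi) => t; rewrite ReImE.
Qed.

Lemma ac_primitiveM a F G f g : 0 <= a ->
  ac_primitive a F f -> ac_primitive a G g ->
  ac_primitive a (fun t => F t * G t) (fun t => f t * G t + F t * g t).
Proof.
move=> a0 /ac_primitiveE[Fr Fi] /ac_primitiveE[Gr Gi]; apply/ac_primitiveE; split.
  apply: eq_primitive_on (primitive_onB (primitive_onM a0 Fr Gr) (primitive_onM
    a0 Fi Gi)) => t;
  rewrite !ReImE; ring.
apply: eq_primitive_on (primitive_onD (primitive_onM a0 Fr Gi) (primitive_onM
  a0 Fi Gr)) => t;
rewrite !ReImE; ring.
Qed.

Lemma ac_primitiveZ a (k : R[i]) F f : 0 <= a -> ac_primitive a F f ->
  ac_primitive a (fun t => k * F t) (fun t => k * f t).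
Proof.
move=> a0 Ff; apply: eq_ac_primitive (ac_primitiveM a0 (ac_primitive_cst k a0)
  Ff) => // t _.
by rewrite mul0r add0r.
Qed.

Lemma ac_primitiveB a F G f g : 0 <= a -> ac_primitive a F f -> ac_primitive a
  G g ->
  ac_primitive a (fun t => F t - G t) (fun t => f t - g t).
Proof.
move=> a0 Ff Gg; apply: eq_ac_primitive (ac_primitiveD Ff (ac_primitiveZ (-1)
  a0 Gg)) => // t _;
by rewrite mulN1r.
Qed.

Lemma cintegral_0 f : cintegral `[0, 0] f = 0.
Proof. by rewrite /cintegral set_itv1 !Rintegral_set1. Qed.

Lemma ac_primitive_cintegral a k f : cintegrable `[0, a] f ->
  ac_primitive a (fun x => k + cintegral `[0, x] f) f.
Proof. by move=> fi; split=> // x _; rewrite cintegral_0 addr0. Qed.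

Lemma ac_primitive_zero a F f : 0 <= a -> ac_primitive a F f ->
  (forall t, 0 <= t <= a -> f t = 0) -> forall x, 0 <= x <= a -> F x = F 0.
Proof.
move=> a0 [fi Ff] f0 x /andP[x0 xa]; rewrite Ff ?x0 //.
rewrite (@eq_cintegral _ _ (fun=> 0)) => [|t /andP[t0 tx]].
  by rewrite /cintegral !Rintegral_cst // !mul0r addr0.
by rewrite f0 // t0 (le_trans tx).
Qed.

Lemma ac_primitive_bounded a F f : 0 <= a -> ac_primitive a F f ->
  exists2 M, 0 <= M & forall t, 0 <= t <= a -> taxi (F t) <= M.
Proof.
move=> a0 /(ac_primitive_continuous a0)[Fr Fi].
have bnd (h : R -> R) : {within `[0, a], continuous h} ->
    exists2 M, 0 <= M & forall t, 0 <= t <= a -> `|h t| <= M.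
  move=> hc; have /compact_bounded[M [_ hM]] :=
    continuous_compact hc (@segment_compact _ 0 a).
  (* [compact_bounded] bounds [h] by every number above [M], which may be negative; |M| + 1 is above
     [M] and nonnegative. *)
  exists (`|M| + 1); first by rewrite addr_ge0.
  move=> t ta; apply: hM; first by rewrite (le_lt_trans (ler_norm M)) // ltrDl.
  by exists t => //=; rewrite in_itv.
have [[M1 M10 h1] [M2 M20 h2]] := (bnd _ Fr, bnd _ Fi).
by exists (M1 + M2); rewrite ?addr_ge0 // => t ta; rewrite lerD ?h1 ?h2.
Qed.

Lemma summable_on_taxi a f : cintegrable `[0, a] f ->
  summable_on a (fun t => taxi (f t)).
Proof. by move=> [fr fi]; apply: summable_onD; apply: summable_on_norm. Qed.

Lemma int0_le a (h : R -> R) x : 0 <= x -> x <= a -> summable_on a h ->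
  (forall t, 0 <= t <= a -> 0 <= h t) -> int0 h x <= int0 h a.
Proof.
move=> x0 xa hi h0; rewrite -subr_ge0 (int0_itv x0 xa (lexx a) hi).
apply: Rintegral_ge0 => t /=; rewrite in_itv /= => /andP[xt ta].
by rewrite h0 // ta (le_trans x0 (ltW xt)).
Qed.

Lemma taxi_cintegral_le a f x : 0 <= x <= a -> cintegrable `[0, a] f ->
  taxi (cintegral `[0, x] f) <= int0 (fun t => taxi (f t)) a.
Proof.
move=> /andP[x0 xa] fi; apply: le_trans (int0_le x0 xa (summable_on_taxi fi)
  _); last first.
  by move=> t _; exact: taxi_ge0.
case: fi => fr fi; rewrite (int0D xa) ?lerD //; try exact: summable_on_norm.
  exact: le_norm_int0 fr.
exact: le_norm_int0 fi.
Qed.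

Lemma taxi_cintegralM_le a F dF f M x : 0 <= x <= a ->
  ac_primitive a F dF -> cintegrable `[0, a] f ->
  (forall t, 0 <= t <= a -> taxi (F t) <= M) ->
  taxi (cintegral `[0, x] (fun t => F t * f t)) <= M * int0 (fun t => taxi (f t)) a.
Proof.
move=> xa FdF fi FM; have a0 : 0 <= a by case/andP: xa => x0; exact: le_trans.
have Ffi := cintegrableMl a0 FdF fi.
apply: le_trans (taxi_cintegral_le xa Ffi) _.
have fs := summable_on_taxi fi.
rewrite -(int0Z M (lexx a) fs); apply: (le_int0 (a := a)) => //.
- exact: summable_on_taxi Ffi.
- exact: summable_onZ.
- by move=> t ta; apply: le_trans (taxiM _ _) _; rewrite ler_wpM2r ?taxi_ge0 ?FM.
Qed.

End ComplexPrimitive.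

(** * Square-integrable functions and Sturm-Liouville equations *)

Section SquareIntegrable.
Context {R : realType}.
Local Notation mu := (@lebesgue_measure R).
Local Notation Re := (@complex.Re R).
Local Notation Im := (@complex.Im R).
Implicit Types (f g F G : R -> R[i]) (a x : R).

(** The squared modulus, kept in [R] because the modulus lives in [R[i]]. *)
Definition sqnorm (u : R[i]) : R := Re u ^+ 2 + Im u ^+ 2.

Lemma sqnorm_ge0 u : 0 <= sqnorm u. Proof. by rewrite addr_ge0 ?sqr_ge0. Qed.

Lemma summable_on_cst a (k : R) : summable_on a (fun=> k).
Proof.
apply: continuous_compact_integrable; first exact: segment_compact.
by move=> x; apply: cvg_cst.
Qed.

Lemma int0_cst a (k : R) : 0 <= a -> int0 (fun=> k) a = k * a.
Proof.
move=> a0; rewrite /int0 Rintegral_cst //; congr (_ * _).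
have := @lebesgue_measure_itv R `[0, a]%R; rewrite /= lte_fin.
case: ltP => [_ h|a0' h]; first by transitivity (fine (a%:E - 0%:E)%E);
  [congr fine|rewrite /= subr0].
by transitivity (fine (0%:E : \bar R)); [congr fine|apply/le_anti/andP].
Qed.

Lemma isL2_sqnorm a f : isL2 a f -> summable_on a (fun t => sqnorm (f t)).
Proof.
move=> [mr mi foo]; apply/integrableP; split.
  by apply/measurable_EFinP; apply: measurable_funD; apply: measurable_funX.
move: foo; rewrite /L2sq; congr (_ < _)%E; apply: eq_integral => t _ /=.
by rewrite ger0_norm // sqnorm_ge0.
Qed.

Lemma isL2I a f : measurable_fun `[0, a] (fun t => Re (f t)) ->
  measurable_fun `[0, a] (fun t => Im (f t)) ->
  summable_on a (fun t => sqnorm (f t)) -> isL2 a f.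
Proof.
move=> mr mi /integrableP[_ foo]; split=> //; move: foo; congr (_ < _)%E.
by apply: eq_integral => t _ /=; rewrite ger0_norm // sqnorm_ge0.
Qed.

Lemma L2sqE a f : isL2 a f -> L2sq a f = (int0 (fun t => sqnorm (f t)) a)%:E.
Proof.
move=> /isL2_sqnorm fi; rewrite /int0 /Rintegral fineK //.
exact: integrable_fin_num.
Qed.

Lemma summable_on_le a (h k : R -> R) : measurable_fun `[0, a] h ->
  (forall t, 0 <= t <= a -> `|h t| <= k t) -> summable_on a k -> summable_on a h.
Proof.
move=> mh hk; apply: le_integrable => //; first exact/measurable_EFinP.
move=> t /=; rewrite in_itv /= => ta; rewrite lee_fin.
by apply: le_trans (hk t ta) (ler_norm _).
Qed.

Lemma isL2_cintegrable a f : isL2 a f -> cintegrable `[0, a] f.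
Proof.
move=> fL2; have fi := isL2_sqnorm fL2; case: fL2 => mr mi _.
(* Both parts are dominated by 1 + |f|^2, because |r| <= 1 + r^2; the constant is summable since the
   interval has finite length. *)
have ki := summable_onD (summable_on_cst a 1) fi.
by split; apply: (summable_on_le _ _ ki) => // t _; rewrite /sqnorm ler_norml;
  have := sqr_ge0 (Re (f t)); have := sqr_ge0 (Im (f t));
  have := sqr_ge0 (Re (f t) - 1); have := sqr_ge0 (Im (f t) - 1);
  have := sqr_ge0 (Re (f t) + 1); have := sqr_ge0 (Im (f t) + 1); nra.
Qed.

Lemma isL2D a f g : isL2 a f -> isL2 a g -> isL2 a (fun t => f t + g t).
Proof.
move=> fL2 gL2; have fi := isL2_sqnorm fL2; have gi := isL2_sqnorm gL2.
case: fL2 gL2 => fr fm _ [gr gm _].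
have mr : measurable_fun `[0, a] (fun t => Re (f t + g t)).
  rewrite (_ : (fun t => _) = (fun t => Re (f t)) \+ (fun t => Re (g t))).
    exact: measurable_funD.
  by apply/funext => t; rewrite ReImE.
have mi : measurable_fun `[0, a] (fun t => Im (f t + g t)).
  rewrite (_ : (fun t => _) = (fun t => Im (f t)) \+ (fun t => Im (g t))).
    exact: measurable_funD.
  by apply/funext => t; rewrite ReImE.
apply: isL2I => //.
apply: (summable_on_le _ _ (summable_onD (summable_onZ 2 fi) (summable_onZ 2 gi))).
  by apply: measurable_funD; apply: measurable_funX.
move=> t _; rewrite ger0_norm ?sqnorm_ge0 // /sqnorm !ReImE.
have := sqr_ge0 (Re (f t) - Re (g t)); have := sqr_ge0 (Im (f t) - Im (g t)); nra.
Qed.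

Lemma ac_primitive_isL2 a F f : 0 <= a -> ac_primitive a F f -> isL2 a F.
Proof.
move=> a0 /(ac_primitive_continuous a0)[Fr Fi].
have ci (h : R -> R) : {within `[0, a], continuous h} -> summable_on a h.
  by move=> hc; apply: continuous_compact_integrable hc; exact: segment_compact.
have cm (h : R -> R) : {within `[0, a], continuous h} -> measurable_fun `[0, a] h.
  by move=> hc; apply: subspace_continuous_measurable_fun.
apply: isL2I; [exact: cm|exact: cm|].
apply: eq_summable_on (summable_onD (summable_onM Fr (ci _ Fr)) (summable_onM
  Fi (ci _ Fi))).
by move=> t _; rewrite /sqnorm; ring.
Qed.

Lemma L2sq_le a F M : 0 <= a -> isL2 a F ->
  (forall t, 0 <= t <= a -> taxi (F t) <= M) -> (L2sq a F <= (M ^+ 2 * a)%:E)%E.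
Proof.
move=> a0 FL2 FM; rewrite (L2sqE FL2) lee_fin -int0_cst //.
apply: (le_int0 (a := a)) => //; [exact: isL2_sqnorm | exact: summable_on_cst |].
move=> t /FM tM; apply: le_trans (sqr_le_taxi _) _.
by have := taxi_ge0 (F t); nra.
Qed.

(** A Cauchy-Schwarz inequality: integrate (taxi(f) - m)^2 >= 0 for a constant [m], then take for
    [m] the mean [I / a]. The factor 2 is that of [taxi_le_sqr]. *)
Lemma sqr_int0_taxi_le a f : 0 < a -> isL2 a f ->
  int0 (fun t => taxi (f t)) a ^+ 2 <= 2 * a * int0 (fun t => sqnorm (f t)) a.
Proof.
move=> a0 fL2; have fi := isL2_sqnorm fL2.
have ti := summable_on_taxi (isL2_cintegrable fL2).
set I := int0 _ a; set N := int0 _ a.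
have h (m : R) : 2 * m * I <= 2 * N + m ^+ 2 * a.
  rewrite -(int0Z _ _ ti) // -(int0Z _ _ fi) // -(int0_cst _ (ltW a0)).
  have ci := summable_on_cst a (m ^+ 2).
  rewrite -(int0D _ _ ci) //; last exact: summable_onZ.
  apply: (le_int0 (a := a)) => //; first exact: summable_onZ.
    by apply: summable_onD => //; exact: summable_onZ.
  move=> t _; have := taxi_le_sqr (f t); rewrite -/(sqnorm _).
  by have := sqr_ge0 (taxi (f t) - m); nra.
have := h (I / a); have -> : (I / a) ^+ 2 * a = I ^+ 2 / a by field; lra.
have -> : 2 * (I / a) * I = 2 * (I ^+ 2 / a) by field; lra.
move=> h1; have h2 : I ^+ 2 / a <= 2 * N by lra.
by move: h2; rewrite ler_pdivrMr //; lra.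
Qed.

End SquareIntegrable.

(** * Wronskians and variation of constants on one edge *)

Section SturmLiouville.
Context {R : realType}.
Variables (a : R) (q : R -> R).
Hypothesis a_gt0 : 0 < a.
Let a0 : 0 <= a := ltW a_gt0.
Implicit Types (y dy z dz f g h : R -> R[i]).

(** Lagrange's identity: in the derivative the terms [dy * dz] and the terms with [q] cancel. *)
Lemma wronskian_primitive y dy g z dz h :
  sturm_liouville a q y dy g -> sturm_liouville a q z dz h ->
  ac_primitive a (fun x => y x * dz x - dy x * z x) (fun x =>
    g x * z x - y x * h x).
Proof.
move=> [y1 y2] [z1 z2].
apply: eq_ac_primitive (ac_primitiveB a0 (ac_primitiveM a0 y1 z2)
  (ac_primitiveM a0 y2 z1)) => // t _.
ring.
Qed.

Lemma sturm_liouvilleD y dy g z dz h :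
  sturm_liouville a q y dy g -> sturm_liouville a q z dz h ->
  sturm_liouville a q (fun x => y x + z x) (fun x => dy x + dz x) (fun x =>
    g x + h x).
Proof.
move=> [y1 y2] [z1 z2]; split; first exact: ac_primitiveD.
by apply: eq_ac_primitive (ac_primitiveD y2 z2) => // t _; ring.
Qed.

Lemma sturm_liouvilleZ (k : R[i]) y dy g : sturm_liouville a q y dy g ->
  sturm_liouville a q (fun x => k * y x) (fun x => k * dy x) (fun x => k * g x).
Proof.
move=> [y1 y2]; split; first exact: ac_primitiveZ.
by apply: eq_ac_primitive (ac_primitiveZ k a0 y2) => // t _; ring.
Qed.

Variables (lambda : R[i]) (C C' S S' : R -> R[i]).
Hypotheses (C_sol : solution a q lambda C C') (C0 : C 0 = 1) (C'0 : C' 0 = 0).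
Hypotheses (S_sol : solution a q lambda S S') (S0 : S 0 = 0) (S'0 : S' 0 = 1).

Lemma wronskian_CS x : 0 <= x <= a -> C x * S' x - C' x * S x = 1.
Proof.
move=> xa; rewrite (ac_primitive_zero a0 (wronskian_primitive C_sol S_sol)) //.
  by rewrite C0 S'0 C'0 mul0r mulr1 subr0.
by move=> t _; ring.
Qed.

(** Variation of constants. With [(U, V) = (C, S)] this is the solution with initial value [A] and
    slope [B]; with [(U, V) = (C', S')] it is its derivative. *)
Definition particular (A B : R[i]) f (U V : R -> R[i]) x :=
  U x * (A + cintegral `[0, x] (fun t => S t * f t))
  + V x * (B - cintegral `[0, x] (fun t => C t * f t)).

(** The Wronskians of [y] with [S] and with [C] are explicit primitives; they form a linear system
    of determinant 1 for the value and slope of [y] at [x]. *)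
Lemma particularE y dy f x :
  cintegrable `[0, a] f ->
  sturm_liouville a q y dy (fun x => lambda * y x + f x) -> 0 <= x <= a ->
  y x = particular (y 0) (dy 0) f C S x /\ dy x = particular (y 0) (dy 0) f C' S' x.
Proof.
move=> fi ysol xa.
have [_ hS] := wronskian_primitive ysol S_sol.
have [_ hC] := wronskian_primitive ysol C_sol.
have W := wronskian_CS xa.
have eS : y x * S' x - dy x * S x = y 0 + cintegral `[0, x] (fun t => S t * f t).
  rewrite hS // S'0 S0 mulr0 mulr1 subr0; congr (_ + _).
  by apply: eq_cintegral => t _; ring.
have eC : dy x * C x - y x * C' x = dy 0 - cintegral `[0, x] (fun t => C t * f t).
  rewrite -opprB hC // C'0 C0 mulr0 mulr1 sub0r opprD opprK; congr (_ - _).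
  by apply: eq_cintegral => t _; ring.
rewrite /particular -eS -eC; split.
  by rewrite -[LHS]mulr1 -W; ring.
by rewrite -[LHS]mulr1 -W; ring.
Qed.

Lemma particular_sol A B f : cintegrable `[0, a] f ->
  sturm_liouville a q (particular A B f C S) (particular A B f C' S')
    (fun x => lambda * particular A B f C S x + f x).
Proof.
move=> fi; case: (C_sol) => Cp Cq; case: (S_sol) => Sp Sq.
have Pp := ac_primitive_cintegral A (cintegrableMl a0 Sp fi).
have Qp := ac_primitiveB a0 (ac_primitive_cst B a0)
  (ac_primitive_cintegral 0 (cintegrableMl a0 Cp fi)).
(* Differentiating the integrals contributes (U S - V C) f, which vanishes for [(C, S)] and is -f
   for [(C', S')] by the Wronskian. *)
have sol U dU V dV (Up : ac_primitive a U dU) (Vp : ac_primitive a V dV) :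
   ac_primitive a (particular A B f U V) (fun x => particular A B f dU dV x
     + (U x * S x - V x * C x) * f x).
  apply: eq_ac_primitive (ac_primitiveD (ac_primitiveM a0 Up Pp) (ac_primitiveM
    a0 Vp Qp)) => // t _;
  rewrite /particular ?add0r //; ring.
split.
  by apply: eq_ac_primitive (sol _ _ _ _ Cp Sp) => // t _; ring.
apply: eq_ac_primitive (sol _ _ _ _ Cq Sq) => // t ta.
rewrite /particular; have -> : C' t * S t - S' t * C t = -1.
  by rewrite -(wronskian_CS ta); ring.
ring.
Qed.

Lemma particular0 A B f U V : particular A B f U V 0 = U 0 * A + V 0 * B.
Proof. by rewrite /particular !cintegral_0 addr0 subr0. Qed.

Lemma particularC0 A B f : particular A B f C S 0 = A.
Proof. by rewrite particular0 C0 S0 mul1r mul0r addr0. Qed.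

Lemma particularC'0 A B f : particular A B f C' S' 0 = B.
Proof. by rewrite particular0 C'0 S'0 mul1r mul0r add0r. Qed.

(** The slope is constant because its derivative vanishes, and its integral over [0, a] is
    [y a - y 0 = 0]; as [a > 0], it is zero. This recovers slopes from values alone. *)
Lemma zero_solution_slope y dy :
  sturm_liouville a q y dy (fun x => lambda * y x) ->
  (forall x, 0 <= x <= a -> y x = 0) -> forall x, 0 <= x <= a -> dy x = 0.
Proof.
move=> [[yi yp] yq] y0.
have dy0 x : 0 <= x <= a -> dy x = dy 0.
  move=> xa; apply: (ac_primitive_zero a0 yq) => // t ta.
  by rewrite y0 // !mulr0 subr0.
suff d0 : dy 0 = 0 by move=> x /dy0 ->.
have aa : 0 <= a <= a by rewrite lexx a0.
have := yp a aa; rewrite !y0 ?lexx ?a0 // add0r (eq_cintegral dy0).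
rewrite /cintegral -/(int0 (fun=> complex.Re (dy 0)) a) -/(int0 (fun=>
  complex.Im (dy 0)) a).
rewrite !int0_cst // => -[/esym/eqP + /esym/eqP].
rewrite !mulf_eq0 (gt_eqF a_gt0) !orbF => /eqP hr /eqP hi.
exact: complex_ext.
Qed.

Lemma eq_sturm_liouville y dy g h : (forall x, 0 <= x <= a -> g x = h x) ->
  sturm_liouville a q y dy g -> sturm_liouville a q y dy h.
Proof.
move=> gh [y1 y2]; split=> //.
by apply: eq_ac_primitive y2 => // t ta; rewrite gh.
Qed.

(** Separates the part linear in [A] and [B], which produces the characteristic matrix, from the
    part linear in [f], which produces the inhomogeneous term. *)
Lemma particular_split A B f U V x : particular A B f U V x =
  U x * A + V x * B + particular 0 0 f U V x.
Proof. by rewrite /particular; ring. Qed.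

Lemma particular_eq0 f U V x : (forall t, f t = 0) -> particular 0 0 f U V x = 0.
Proof.
move=> f0; rewrite /particular.
have z (h : R -> R[i]) : cintegral `[0, x] (fun t => h t * f t) = 0.
  rewrite (@eq_cintegral _ _ _ (fun=> 0)) => [|t _]; last by rewrite f0 mulr0.
  by rewrite /cintegral !Rintegral_cst // !mul0r.
by rewrite !z; ring.
Qed.

(** One constant serves all data, as the norm bound on the resolvent requires: [C], [S] and their
    derivatives are bounded on [0, a], so the integrals are at most a constant times the L^1 norm of
    [f]. *)
Lemma particular_bounded : exists2 M, 0 <= M & forall A B f x,
  cintegrable `[0, a] f -> 0 <= x <= a ->
  let I := int0 (fun t => taxi (f t)) a in
  taxi (particular A B f C S x) <= M * (taxi A + taxi B + I) /\
  taxi (particular A B f C' S' x) <= M * (taxi A + taxi B + I).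
Proof.
have [Mc Mc0 hc] := ac_primitive_bounded a0 C_sol.1.
have [Ms Ms0 hs] := ac_primitive_bounded a0 S_sol.1.
have [Mc' Mc'0 hc'] := ac_primitive_bounded a0 C_sol.2.
have [Ms' Ms'0 hs'] := ac_primitive_bounded a0 S_sol.2.
pose N := Mc + Ms + Mc' + Ms'.
exists (2 * N * (1 + N)) => [|A B f x fi xa I]; first by rewrite /N; nra.
have I0 : 0 <= I by apply: int0_ge0 => t _; exact: taxi_ge0.
have hS := taxi_cintegralM_le xa S_sol.1 fi hs.
have hC := taxi_cintegralM_le xa C_sol.1 fi hc.
suff gen U V : taxi (U x) <= N -> taxi (V x) <= N ->
    taxi (particular A B f U V x) <= 2 * N * (1 + N) * (taxi A + taxi B + I).
  have /[!xa] hx := (hc x, hs x, hc' x, hs' x).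
  have [[[/(_ isT) h1 /(_ isT) h2] /(_ isT) h3] /(_ isT) h4] := hx.
  by split; apply: gen; rewrite /N; lra.
have N0 : 0 <= N by rewrite /N; lra.
move=> hU hV; rewrite /particular.
set P := A + _; set Q := B - _.
have hP : taxi P <= taxi A + N * I.
  apply: le_trans (taxiD _ _) _; rewrite lerD2l; apply: le_trans hS _.
  by rewrite ler_wpM2r // /N; lra.
have hQ : taxi Q <= taxi B + N * I.
  apply: le_trans (taxiD _ _) _; rewrite lerD2l taxiN; apply: le_trans hC _.
  by rewrite ler_wpM2r // /N; lra.
have A0 := taxi_ge0 A; have B0 := taxi_ge0 B.
have hUP : taxi (U x * P) <= N * (taxi A + N * I).
  by apply: le_trans (taxiM _ _) _; apply: ler_pM; rewrite ?taxi_ge0.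
have hVQ : taxi (V x * Q) <= N * (taxi B + N * I).
  by apply: le_trans (taxiM _ _) _; apply: ler_pM; rewrite ?taxi_ge0.
apply: le_trans (taxiD _ _) _.
(* With these products nonnegative, the final comparison is linear in the monomials. *)
have p1 := mulr_ge0 N0 A0; have p2 := mulr_ge0 N0 B0; have p3 := mulr_ge0 N0 I0.
have p4 := mulr_ge0 N0 p1; have p5 := mulr_ge0 N0 p2; have p6 := mulr_ge0 N0 p3.
have -> : 2 * N * (1 + N) * (taxi A + taxi B + I) =
  2 * (N * taxi A + N * taxi B + N * I + N * (N * taxi A) + N * (N * taxi B) +
    N * (N * I)) by ring.
have e1 : N * (taxi A + N * I) = N * taxi A + N * (N * I) by ring.
have e2 : N * (taxi B + N * I) = N * taxi B + N * (N * I) by ring.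
rewrite e1 in hUP; rewrite e2 in hVQ; lra.
Qed.

End SturmLiouville.

(** * Vertex conditions *)

Section Phase.
Context {R : realType}.

Lemma expiD (s t : R) : expi (s + t) = expi s * expi t.
Proof. by apply/eqP; rewrite eq_complex /= cosD sinD addrC !eqxx /= addrC [cos
  s * _]mulrC addrC eqxx. Qed.

Lemma expi0 : expi (0 : R) = 1. Proof. by rewrite /expi cos0 sin0. Qed.

Lemma expiNK (t : R) : expi t * expi (- t) = 1.
Proof. by rewrite -expiD subrr expi0. Qed.

Lemma expi_addN (t : R) : expi t + expi (- t) = 2 * (cos t)%:C.
Proof. by apply/eqP; rewrite eq_complex /= cosN sinN subrr; apply/andP; split;
  apply/eqP; ring. Qed.

Definition bloch_phase (theta1 theta2 : R) (p : cell) : R[i] :=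
  expi (p.1%:~R * theta1 + p.2%:~R * theta2).

Variables theta1 theta2 : R.
Local Notation phase := (bloch_phase theta1 theta2).

Lemma phaseD n p : phase (n + p) = phase n * phase p.
Proof. by rewrite /bloch_phase -expiD /= !intrD; congr expi; ring. Qed.

Lemma phase0 : phase 0 = 1.
Proof. by rewrite /bloch_phase !mul0r addr0 expi0. Qed.

Lemma phaseNK p : phase p * phase (- p) = 1.
Proof. by rewrite -phaseD subrr phase0. Qed.

End Phase.

Section Ord.

Lemma forall_ord6 (P : 'I_6 -> Prop) :
  P (inord 0) -> P (inord 1) -> P (inord 2) -> P (inord 3) -> P (inord 4) ->
  P (inord 5) -> forall j, P j.
Proof.
move=> p0 p1 p2 p3 p4 p5 j; rewrite -(inord_val j).
by case: j => [[|[|[|[|[|[|j]]]]]] ltj].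
Qed.

Lemma forall_ord3 (P : 'I_3 -> Prop) :
  P (inord 0) -> P (inord 1) -> P (inord 2) -> forall i, P i.
Proof.
move=> p0 p1 p2 i; rewrite -(inord_val i).
by case: i => [[|[|[|i]]] lti].
Qed.

Lemma sum_inord (K : nmodType) n (F : 'I_n.+1 -> K) :
  \sum_(j < n.+1) F j = \sum_(0 <= k < n.+1) F (inord k).
Proof. by rewrite big_mkord; apply: eq_bigr => j _; rewrite inord_val. Qed.

Lemma src0_inord k : (k < 6)%N ->
  src0 (inord k) = nth (inord 0, 0) [:: (inord 0, 0); (inord 2, 0); (inord 0, 0);
    (inord 0, 0); (inord 2, (0, -1)); (inord 0, 0)] k.
Proof. by move=> k6; rewrite /src0 (tnth_nth (inord 0, 0)) inordK. Qed.

Lemma tgt0_inord k : (k < 6)%N ->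
  tgt0 (inord k) = nth (inord 0, 0) [:: (inord 2, 0); (inord 1, 0); (inord 1, 0);
    (inord 1, (-1, 0)); (inord 1, (-1, 0)); (inord 2, (0, -1))] k.
Proof. by move=> k6; rewrite /tgt0 (tnth_nth (inord 0, 0)) inordK. Qed.

End Ord.

Section VertexForms.
Context {K : comNzRingType}.
Implicit Types A B Y D : 'I_6 -> K.

(* A, B are the values and slopes at the starts of the edges, Y, D at the ends. *)
Definition vertex_forms (al be : K) A B Y D : seq K :=
  [:: A.{1} - A.{3};
      A.{1} - A.{4};
      A.{1} - A.{6};
      B.{1} + B.{3} + B.{4} + B.{6};
      Y.{2} - Y.{3};
      Y.{2} - al * Y.{4};
      Y.{2} - al * Y.{5};
      D.{2} + D.{3} + al * D.{4} + al * D.{5};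
      A.{2} - be * A.{5};
      A.{2} - be * Y.{6};
      A.{2} - Y.{1};
      D.{1} + be * D.{6} - B.{2} - be * B.{5}].

(** By linearity, substituting the end values of the edge solutions gives the rows of the matrix
    plus a term independent of [A] and [B]. *)
Lemma vertex_formsE (c c' s s' G H : 'I_6 -> K) (al be : K) A B i :
  (vertex_forms al be A B (fun j => c j * A j + s j * B j + G j)
    (fun j => c' j * A j + s' j * B j + H j))`_i =
  (bloch_forms c c' s s' al be A B)`_i +
  (vertex_forms al be (fun=> 0) (fun=> 0) G H)`_i.
Proof.
by move: i => [|[|[|[|[|[|[|[|[|[|[|[|i]]]]]]]]]]]] /=; rewrite ?nth_nil; ring.
Qed.

Lemma bloch_matrix_mul (c c' s s' : 'I_6 -> K) (al be : K) (X : 'cV_12) i :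
  (bloch_matrix c c' s s' al be *m X) i 0 =
  (bloch_forms c c' s s' al be (fun j => X (inord j) 0) (fun j =>
    X (inord (6 + j)) 0))`_i.
Proof.
rewrite mxE sum_inord.
under eq_big_nat => k k12 do rewrite mxE inordK //.
rewrite unlock /=.
case: i => [[|[|[|[|[|[|[|[|[|[|[|[|i]]]]]]]]]]]] lti] //=;
  rewrite !inordK //= ?addn0 ?addn1; ring.
Qed.

End VertexForms.

Section VertexConditions.
Context {R : realType}.
Variables (a theta1 theta2 : R) (y dy : @graph_fun R).
Local Notation al := (expi theta1).
Local Notation be := (expi theta2).
Local Notation phase := (bloch_phase theta1 theta2).
Variables (A B Y D : 'I_6 -> R[i]).
Hypotheses (yA : forall j n, y (j, n) 0 = phase n * A j)
           (yY : forall j n, y (j, n) a = phase n * Y j)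
           (dyB : forall j n, dy (j, n) 0 = phase n * B j)
           (dyD : forall j n, dy (j, n) a = phase n * D j).

Lemma continuous_at_verticesP : continuous_at_vertices a y <->
  exists U : 'I_3 -> R[i], forall j,
    phase (- (src0 j).2) * A j = U (src0 j).1 /\
    phase (- (tgt0 j).2) * Y j = U (tgt0 j).1.
Proof.
split=> [[u yu]|[U yU]].
  exists (fun i => u (i, 0)) => j; rewrite -yA -yY; split.
    by have [-> _] := yu (j, - (src0 j).2); rewrite /src /= addNr.
  by have [_ ->] := yu (j, - (tgt0 j).2); rewrite /tgt /= addNr.
exists (fun v => phase v.2 * U v.1) => -[j n]; have [<- <-] := yU j.
by rewrite yA yY /= !phaseD -!mulrA !(mulrA (phase (_ j).2)) !phaseNK !mul1r.
Qed.

Lemma kirchhoffP : kirchhoff a dy <-> forall i : 'I_3,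
  \sum_(j | (src0 j).1 == i) phase (- (src0 j).2) * B j
  - \sum_(j | (tgt0 j).1 == i) phase (- (tgt0 j).2) * D j = 0.
Proof.
have E v : \sum_(j | (src0 j).1 == v.1) dy (edge_from v j) 0
    - \sum_(j | (tgt0 j).1 == v.1) dy (edge_to v j) a =
  phase v.2 * (\sum_(j | (src0 j).1 == v.1) phase (- (src0 j).2) * B j
  - \sum_(j | (tgt0 j).1 == v.1) phase (- (tgt0 j).2) * D j).
  rewrite mulrBr !mulr_sumr; congr (_ - _); apply: eq_bigr => j _.
    by rewrite dyB phaseD mulrA.
  by rewrite dyD phaseD mulrA.
split=> [h i|h v]; last by rewrite E h mulr0.
by have := h (i, 0); rewrite E phase0 mul1r.
Qed.

Lemma vertex_conditionsP :
  continuous_at_vertices a y /\ kirchhoff a dy <->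
  forall i, (vertex_forms al be A B Y D)`_i = 0.
Proof.
have ph0 : phase (- 0) = 1 by rewrite oppr0 phase0.
(* An end in the cell at -k1 is moved back by k1, whence the factor [al]; likewise [be] for k2. *)
have pha : phase (- (-1, 0)) = al.
  by rewrite /bloch_phase /= opprK oppr0 mul1r mul0r addr0.
have phb : phase (- (0, -1)) = be.
  by rewrite /bloch_phase /= opprK oppr0 mul1r mul0r add0r.
have inE3 (k l : nat) : (k < 3)%N -> (l < 3)%N ->
    ((inord k : 'I_3) == inord l) = (k == l).
  by move=> k3 l3; rewrite -val_eqE /= !inordK.
have sumE (F : 'I_6 -> R[i]) (P : pred 'I_6) : \sum_(j | P j) F j =
    \sum_(0 <= k < 6) (if P (inord k) then F (inord k) else 0).
  by rewrite big_mkcond sum_inord.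
rewrite continuous_at_verticesP kirchhoffP; split.
  move=> [[U yU] kir].
  have [e1 f1] := yU (inord 0); have [e2 f2] := yU (inord 1);
    have [e3 f3] := yU (inord 2).
  have [e4 f4] := yU (inord 3); have [e5 f5] := yU (inord 4);
    have [e6 f6] := yU (inord 5).
  move: e1 e2 e3 e4 e5 e6 f1 f2 f3 f4 f5 f6.
  rewrite !src0_inord // !tgt0_inord //= !ph0 !pha !phb !mul1r.
  move=> e1 e2 e3 e4 e5 e6 f1 f2 f3 f4 f5 f6.
  have := kir (inord 0); have := kir (inord 1); have := kir (inord 2).
  rewrite !sumE unlock /= !src0_inord // !tgt0_inord //= !ph0 !pha !phb !inE3
    //= => k2 k1 k0.
  move=> [|[|[|[|[|[|[|[|[|[|[|[|i]]]]]]]]]]]] /=; rewrite ?nth_nil //.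
  - by rewrite e1 e3 subrr.
  - by rewrite e1 e4 subrr.
  - by rewrite e1 e6 subrr.
  - by rewrite -k0; ring.
  - by rewrite f2 f3 subrr.
  - by rewrite f2 f4 subrr.
  - by rewrite f2 f5 subrr.
  - by rewrite -[RHS]oppr0 -k1; ring.
  - by rewrite e2 e5 subrr.
  - by rewrite e2 f6 subrr.
  - by rewrite e2 f1 subrr.
  - by rewrite -[RHS]oppr0 -k2; ring.
move=> h.
have eqh i u v : (vertex_forms al be A B Y D)`_i = u - v -> u = v.
  by rewrite h => /esym/eqP; rewrite subr_eq0 => /eqP.
have r1 := @eqh 0%N _ _ erefl; have r2 := @eqh 1%N _ _ erefl;
  have r3 := @eqh 2%N _ _ erefl.
have r5 := @eqh 4%N _ _ erefl; have r6 := @eqh 5%N _ _ erefl;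
  have r7 := @eqh 6%N _ _ erefl.
have r9 := @eqh 8%N _ _ erefl; have r10 := @eqh 9%N _ _ erefl;
  have r11 := @eqh 10%N _ _ erefl.
have r4 := h 3%N; have r8 := h 7%N; have r12 := h 11%N; rewrite /= in r4 r8 r12.
split.
  (* The vertex values in cell 0: [e_1] starts at v_1, and [e_2] ends at v_2 and starts at v_3. *)
  exists (fun i => nth 0 [:: A.{1}; Y.{2}; A.{2}] i).
  by apply: forall_ord6; rewrite src0_inord // tgt0_inord //= ?ph0 ?pha ?phb
    !inordK //= ?mul1r; split.
apply: forall_ord3; rewrite !sumE unlock /= !src0_inord // !tgt0_inord //= !ph0
  !pha !phb !inE3 //=.
- by rewrite -[RHS]r4; ring.
- by apply: oppr_inj; rewrite oppr0 -[RHS]r8; ring.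
- by apply: oppr_inj; rewrite oppr0 -[RHS]r12; ring.
Qed.

End VertexConditions.

(** * The resolvent of the Bloch Hamiltonian *)

Section VertexFormsBound.
Context {R : realType}.

Lemma taxi_expi (t : R) : taxi (expi t) <= 2.
Proof. by rewrite /taxi /=; have := cos_max t; have := sin_max t; lra. Qed.

(** A phase has [taxi] at most 2, so the longest form, with two plain terms and two phased ones,
    contributes 6; the constant 8 leaves room. *)
Lemma taxi_vertex_forms (theta1 theta2 T : R) (G H : 'I_6 -> R[i]) i :
  (forall j, taxi (G j) <= T) -> (forall j, taxi (H j) <= T) ->
  taxi (vertex_forms (expi theta1) (expi theta2) (fun=> 0) (fun=>
    0) G H)`_i <= 8 * T.
Proof.
move=> GT HT; have T0 : 0 <= T by apply: le_trans (taxi_ge0 _) (GT ord0).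
have bd0 : taxi (0 : R[i]) <= 0 * T by rewrite taxi0 mul0r.
have bdD k l (u v : R[i]) : taxi u <= k * T -> taxi v <= l * T ->
    taxi (u + v) <= (k + l) * T.
  by move=> hu hv; apply: le_trans (taxiD _ _) _; rewrite mulrDl lerD.
have bdN k (u : R[i]) : taxi u <= k * T -> taxi (- u) <= k * T by rewrite taxiN.
have bdM k t (u : R[i]) : taxi u <= k * T -> taxi (expi t * u) <= (2 * k) * T.
  move=> hu; apply: le_trans (taxiM _ _) _; rewrite -mulrA.
  by apply: ler_pM; rewrite ?taxi_ge0 ?taxi_expi.
have bdG j : taxi (G j) <= 1 * T by rewrite mul1r.
have bdH j : taxi (H j) <= 1 * T by rewrite mul1r.
have bd8 k (u : R[i]) : taxi u <= k * T -> k <= 8 -> taxi u <= 8 * T.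
  by move=> hu k8; apply: le_trans hu _; rewrite ler_wpM2r.
(* The coefficient of [T] is built up by unification along each form, and [lra] finally compares it
   with 8. *)
move: i => [|[|[|[|[|[|[|[|[|[|[|[|l]]]]]]]]]]]] /=; rewrite ?nth_nil; (eapply bd8;
  [repeat lazymatch goal with
   | |- is_true (taxi (_ + _) <= _) => eapply bdD
   | |- is_true (taxi (- _) <= _) => eapply bdN
   | |- is_true (taxi (_ * _) <= _) => eapply bdM
   | |- is_true (taxi (G _) <= _) => apply bdG
   | |- is_true (taxi (H _) <= _) => apply bdH
   | |- _ => apply bd0
   end|]); lra.
Qed.

End VertexFormsBound.

Section BlochResolvent.
Context {R : realType}.
Variables (a : R) (q : 'I_6 -> R -> R) (lambda : R[i]).
Hypothesis a_gt0 : 0 < a.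
Let a0 : 0 <= a := ltW a_gt0.
Variables (C C' S S' : 'I_6 -> R -> R[i]).
Hypotheses (C_sol : forall j, solution a (q j) lambda (C j) (C' j))
  (C_init : forall j, C j 0 = 1 /\ C' j 0 = 0)
  (S_sol : forall j, solution a (q j) lambda (S j) (S' j))
  (S_init : forall j, S j 0 = 0 /\ S' j 0 = 1).
Variables theta1 theta2 : R.
Local Notation al := (expi theta1).
Local Notation be := (expi theta2).
Local Notation phase := (bloch_phase theta1 theta2).
Implicit Types (f y : @graph_fun R) (A B : 'I_6 -> R[i]).

Let M := bloch_matrix (C^~ a) (C'^~ a) (S^~ a) (S'^~ a) al be.

Definition edge_solution (U V : 'I_6 -> R -> R[i]) A B f (j : 'I_6) : R -> R[i] :=
  particular (C j) (S j) (A j) (B j) (f (j, 0)) (U j) (V j).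

Definition bloch_extension (y0 : 'I_6 -> R -> R[i]) : @graph_fun R :=
  fun e x => phase e.2 * y0 e.1 x.

(** The inhomogeneous term of the linear system: the vertex forms of the solution with zero initial
    data on every edge. *)
Definition defect f : seq R[i] :=
  vertex_forms al be (fun=> 0) (fun=> 0)
    (fun j => edge_solution C S (fun=> 0) (fun=> 0) f j a)
    (fun j => edge_solution C' S' (fun=> 0) (fun=> 0) f j a).

Definition solves f y :=
  bloch_hamiltonian a q theta1 theta2 y (fun e x => lambda * y e x + f e x).

Lemma forms_defect A B f i :
  (vertex_forms al be A B (fun j => edge_solution C S A B f j a)
    (fun j => edge_solution C' S' A B f j a))`_i =
  (bloch_forms (C^~ a) (C'^~ a) (S^~ a) (S'^~ a) al be A B)`_i + (defect f)`_i.
Proof.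
rewrite -vertex_formsE; congr (vertex_forms al be A B _ _)`_i.
  by apply/funext => j; rewrite /edge_solution particular_split.
by apply/funext => j; rewrite /edge_solution particular_split.
Qed.

Lemma bloch_L2_quasi f j n x : bloch_L2 a theta1 theta2 f -> 0 <= x <= a ->
  f (j, n) x = phase n * f (j, 0) x.
Proof. by move=> [fq _] xa; rewrite -(fq j 0 n x xa) add0r. Qed.

Lemma edge_solution_sol A B f j : bloch_L2 a theta1 theta2 f ->
  sturm_liouville a (q j) (edge_solution C S A B f j) (edge_solution C' S' A B f j)
    (fun x => lambda * edge_solution C S A B f j x + f (j, 0) x).
Proof.
move=> [_ fL2]; have [C0 C'0] := C_init j; have [S0 S'0] := S_init j.
by apply: particular_sol => //; apply: isL2_cintegrable.
Qed.

(** Coefficients solving the linear system satisfy the vertex conditions modulo translations, and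
    the phases carry the solution to all cells. *)
Lemma solves_edge_solution A B f : bloch_L2 a theta1 theta2 f ->
  (forall i, (bloch_forms (C^~ a) (C'^~ a) (S^~ a) (S'^~ a) al be A B)`_i
     + (defect f)`_i = 0) ->
  solves f (bloch_extension (edge_solution C S A B f)).
Proof.
move=> fL2 AB0; have sol j := edge_solution_sol A B j fL2.
exists (bloch_extension (edge_solution C' S' A B f)).
have [ct kir] : continuous_at_vertices a (bloch_extension (edge_solution C S A
  B f)) /\
    kirchhoff a (bloch_extension (edge_solution C' S' A B f)).
  apply/(@vertex_conditionsP _ a theta1 theta2 _ _ A B
    (fun j => edge_solution C S A B f j a) (fun j =>
      edge_solution C' S' A B f j a)) => //.
  - move=> j n; have [C0 _] := C_init j; have [S0 _] := S_init j.
    by rewrite /bloch_extension /edge_solution particularC0.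
  - move=> j n; have [_ C'0] := C_init j; have [_ S'0] := S_init j.
    by rewrite /bloch_extension /edge_solution particularC'0.
  - by move=> i; rewrite forms_defect.
have yq : quasi_periodic a theta1 theta2 (bloch_extension (edge_solution C S A
  B f)).
  by move=> j n p x _; rewrite /bloch_extension /= phaseD -/(phase p) mulrCA
    -mulrA mulrCA.
split=> //.
- move=> [j n]; apply: eq_sturm_liouville (sturm_liouvilleZ a_gt0 (phase n)
  (sol j)) => //.
  by move=> x xa; rewrite (bloch_L2_quasi _ _ fL2 xa) /bloch_extension /=; ring.
- split=> [j n p x xa|j].
    by rewrite (fL2.1 _ _ _ _ xa) (yq _ _ _ _ xa); ring.
  apply: isL2D; last exact: fL2.2.
  have [yp _] := sol j; rewrite /bloch_extension /=.
  exact: ac_primitive_isL2 a0 (ac_primitiveZ lambda a0 (ac_primitiveZ (phase 0)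
    a0 yp)).
Qed.

Lemma solves_unique f y : bloch_L2 a theta1 theta2 f -> solves f y ->
  exists A B,
    (forall i, (bloch_forms (C^~ a) (C'^~ a) (S^~ a) (S'^~ a) al be A B)`_i
       + (defect f)`_i = 0) /\
    forall e x, 0 <= x <= a -> y e x = bloch_extension (edge_solution C S A B
      f) e x.
Proof.
move=> fL2 [dy [ysol yc ky yq gL2]].
have fi j : cintegrable `[0, a] (f (j, 0)) by apply: isL2_cintegrable; exact: fL2.2.
have yE j n x : 0 <= x <= a -> y (j, n) x = phase n * y (j, 0) x.
  by move=> xa; rewrite -(yq j 0 n x xa) add0r.
(* Quasi-periodicity is imposed on [y] alone; the difference between [y] on a translated edge and
   its phased copy is a vanishing solution, so its slope vanishes too. *)
have dyE j n x : 0 <= x <= a -> dy (j, n) x = phase n * dy (j, 0) x.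
  move=> xa; apply/eqP; rewrite -subr_eq0 -mulNr; apply/eqP; move: x xa.
  apply: (@zero_solution_slope _ a (q j) a_gt0 lambda
    (fun x => y (j, n) x + - phase n * y (j, 0) x)
    (fun x => dy (j, n) x + - phase n * dy (j, 0) x)); last first.
    by move=> x xa; rewrite yE //; ring.
  have h := sturm_liouvilleD a_gt0 (ysol (j,
    n)) (sturm_liouvilleZ a_gt0 (- phase n) (ysol (j, 0))).
  apply: eq_sturm_liouville h => // x xa.
  by rewrite (bloch_L2_quasi _ _ fL2 xa); ring.
pose A j := y (j, 0) 0; pose B j := dy (j, 0) 0.
have rep j x : 0 <= x <= a -> y (j, 0) x = edge_solution C S A B f j x /\
    dy (j, 0) x = edge_solution C' S' A B f j x.
  move=> xa; have [C0 C'0] := C_init j; have [S0 S'0] := S_init j.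
  by apply: (particularE a_gt0 (C_sol j) C0 C'0 (S_sol j) S0 S'0 (fi j) (ysol
    (j, 0))).
have z0 : 0 <= (0 : R) <= a by rewrite lexx a0.
have za : 0 <= a <= a by rewrite lexx a0.
exists A, B; split=> [i|[j n] x xa]; last first.
  by rewrite yE // (rep j x xa).1.
rewrite -forms_defect; move: i.
apply/(@vertex_conditionsP _ a theta1 theta2 y dy); last by [].
- by move=> j n; rewrite yE.
- by move=> j n; rewrite yE // (rep j a za).1.
- by move=> j n; rewrite dyE.
- by move=> j n; rewrite dyE // (rep j a za).2.
Qed.

Lemma bloch_L2_0 : bloch_L2 a theta1 theta2 (fun _ _ => 0).
Proof.
split=> [j n p x _|j]; first by rewrite mulr0.
by apply: (@ac_primitive_isL2 _ a _ (fun=> 0)) => //; exact: ac_primitive_cst.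
Qed.

Lemma defect0 i : (defect (fun _ _ => 0))`_i = 0.
Proof.
rewrite /defect /vertex_forms /edge_solution !particular_eq0 //.
by move: i => [|[|[|[|[|[|[|[|[|[|[|[|i]]]]]]]]]]]] /=; rewrite ?nth_nil //; ring.
Qed.

(** A kernel vector of [M] yields a solution for zero data; uniqueness identifies it with the zero
    solution, so all its coefficients vanish, a contradiction. *)
Lemma resolvent_det_neq0 : bloch_resolvent_set a q theta1 theta2 lambda -> \det
  M != 0.
Proof.
move=> [m res]; apply/negP => /eqP M0.
(* [det0P] supplies a row vector multiplying from the left, hence the transpose. *)
have : \det M^T == 0 by rewrite det_tr M0.
case/det0P => v vn0 vM; have Mv : M *m v^T = 0.
  by rewrite -[M]trmxK -trmx_mul vM trmx0.
have [ys [_ _ uniq]] := res _ bloch_L2_0.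
have zE A B : (forall i, (bloch_forms (C^~ a) (C'^~ a) (S^~ a) (S'^~ a) al be A
  B)`_i = 0) ->
    forall e x, 0 <= x <= a ->
    bloch_extension (edge_solution C S A B (fun _ _ => 0)) e x = ys e x.
  move=> AB; apply: uniq; apply: solves_edge_solution; first exact: bloch_L2_0.
  by move=> i; rewrite AB defect0 addr0.
pose A (j : 'I_6) := v^T (inord j) 0; pose B (j : 'I_6) := v^T (inord (6 + j)) 0.
have AB i : (bloch_forms (C^~ a) (C'^~ a) (S^~ a) (S'^~ a) al be A B)`_i = 0.
  case: (ltnP i 12) => i12; last by rewrite nth_default.
  by rewrite -(bloch_matrix_mul _ _ _ _ _ _ _ (Ordinal i12)) -/M Mv mxE.
have AB0 i : (bloch_forms (C^~ a) (C'^~ a) (S^~ a) (S'^~ a) al be (fun=>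
  0) (fun=> 0))`_i = 0.
  by move: i => [|[|[|[|[|[|[|[|[|[|[|[|i]]]]]]]]]]]] /=; rewrite ?nth_nil //; ring.
have y0 j x : 0 <= x <= a -> edge_solution C S A B (fun _ _ => 0) j x = 0.
  move=> xa; have := zE A B AB (j, 0) x xa; rewrite -(zE _ _ AB0 (j, 0) x xa).
  by rewrite /bloch_extension /= phase0 !mul1r => ->;
    rewrite /edge_solution particular_eq0.
have dy0 j x : 0 <= x <= a -> edge_solution C' S' A B (fun _ _ => 0) j x = 0.
  move: x; apply: zero_solution_slope (y0 j) => //.
  apply: eq_sturm_liouville (edge_solution_sol A B j bloch_L2_0) => //.
  by move=> x _; rewrite addr0.
have z0 : 0 <= (0 : R) <= a by rewrite lexx a0.
have A0 j : A j = 0.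
  have [C0 _] := C_init j; have [S0 _] := S_init j.
  by rewrite -(y0 j 0 z0) /edge_solution particularC0.
have B0 j : B j = 0.
  have [_ C'0] := C_init j; have [_ S'0] := S_init j.
  by rewrite -(dy0 j 0 z0) /edge_solution particularC'0.
move/eqP: vn0; apply; apply/rowP => k; rewrite mxE.
case: (ltnP k 6) => k6.
  by have := A0 (inord k); rewrite /A mxE inordK // inord_val.
have k12 : (k - 6 < 6)%N by have := ltn_ord k; lia.
by have := B0 (inord (k - 6)); rewrite /B mxE inordK // subnKC // inord_val.
Qed.

Definition total_taxi f : R := \sum_j int0 (fun t => taxi (f (j, 0) t)) a.

Lemma edge_solution_bounded : exists2 m, 0 <= m & forall A B f j x,
  bloch_L2 a theta1 theta2 f -> 0 <= x <= a ->
  taxi (edge_solution C S A B f j x) <= m * (taxi (A j) + taxi (B j) +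
    total_taxi f) /\
  taxi (edge_solution C' S' A B f j x) <= m * (taxi (A j) + taxi (B j) +
    total_taxi f).
Proof.
have /choice[m mP] : forall j, exists m : R, 0 <= m /\
    forall (u v : R[i]) (f : R -> R[i]) x,
    cintegrable `[0, a] f -> 0 <= x <= a ->
    let I := int0 (fun t => taxi (f t)) a in
    taxi (particular (C j) (S j) u v f (C j) (S j) x) <= m * (taxi u + taxi v +
      I) /\
    taxi (particular (C j) (S j) u v f (C' j) (S' j) x) <= m * (taxi u + taxi v
      + I).
  move=> j; have [m m0 mP] := particular_bounded a_gt0 (C_sol j) (S_sol j).
  by exists m.
(* The sum of the nonnegative constants serves as an upper bound for each of them. *)
exists (\sum_j m j) => [|A B f j x fL2 xa]; first by apply: sumr_ge0 => j _;
  exact: (mP j).1.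
have fi k : cintegrable `[0, a] (f (k, 0)) by apply: isL2_cintegrable; exact: fL2.2.
have I0 k : 0 <= int0 (fun t => taxi (f (k, 0) t)) a.
  by apply: int0_ge0 => t _; exact: taxi_ge0.
have mle : m j <= \sum_j m j.
  by rewrite (bigD1 j) //= lerDl; apply: sumr_ge0 => k _; exact: (mP k).1.
have Ile : int0 (fun t => taxi (f (j, 0) t)) a <= total_taxi f.
  by rewrite /total_taxi (bigD1 j) //= lerDl; apply: sumr_ge0.
have [h1 h2] := (mP j).2 (A j) (B j) (f (j, 0)) x (fi j) xa.
have A0 := taxi_ge0 (A j); have B0 := taxi_ge0 (B j); have Ij := I0 j;
  have mj := (mP j).1.
have le : m j * (taxi (A j) + taxi (B j) + int0 (fun t => taxi (f (j, 0) t)) a) <=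
    (\sum_j m j) * (taxi (A j) + taxi (B j) + total_taxi f).
  by apply: ler_pM => //; [rewrite !addr_ge0|rewrite lerD2l].
by split; [exact: le_trans h1 le | exact: le_trans h2 le].
Qed.

Lemma defect_bounded : exists2 m, 0 <= m & forall f i,
  bloch_L2 a theta1 theta2 f -> taxi (defect f)`_i <= m * total_taxi f.
Proof.
have [m m0 mP] := edge_solution_bounded.
exists (8 * m) => [|f i fL2]; first by rewrite mulr_ge0.
have za : 0 <= a <= a by rewrite lexx a0.
by rewrite -mulrA; apply: taxi_vertex_forms => j;
  have [] := mP (fun=> 0) (fun=> 0) f j a fL2 za; rewrite taxi0 !add0r.
Qed.

Lemma sqr_total_taxi_le f : bloch_L2 a theta1 theta2 f ->
  total_taxi f ^+ 2 <= 72 * a * \sum_j int0 (fun t => sqnorm (f (j, 0) t)) a.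
Proof.
move=> [_ fL2]; set N := \sum_j _.
have n0 j : 0 <= int0 (fun t => sqnorm (f (j, 0) t)) a.
  by apply: int0_ge0 => t _; exact: sqnorm_ge0.
have N0 : 0 <= N by apply: sumr_ge0.
have le j : int0 (fun t => taxi (f (j, 0) t)) a <= Num.sqrt (2 * a * N).
  rewrite -[leLHS]ger0_norm; last by apply: int0_ge0 => t _; exact: taxi_ge0.
  rewrite -sqrtr_sqr ler_sqrt; last by rewrite !mulr_ge0.
  apply: le_trans (sqr_int0_taxi_le a_gt0 (fL2 j)) _.
  rewrite ler_wpM2l ?mulr_ge0 // /N (bigD1 j) //= lerDl; exact: sumr_ge0.
(* 72 = 6^2 * 2: six edges, each contributing at most the square root of [2 * a * N]. *)
have -> : 72 * a * N = (6 * Num.sqrt (2 * a * N)) ^+ 2.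
  by rewrite exprMn sqr_sqrtr ?mulr_ge0 //; ring.
apply: lerXn2r; rewrite ?nnegrE.
- by apply: sumr_ge0 => j _; apply: int0_ge0 => t _; exact: taxi_ge0.
- by rewrite mulr_ge0 ?sqrtr_ge0.
apply: (@le_trans _ _ (\sum_(j < 6) Num.sqrt (2 * a * N))); first exact: ler_sum.
by rewrite sumr_const card_ord [leRHS]mulr_natl.
Qed.

(** The invertible system has exactly one solution, bounded linearly by the defect; this gives
    existence, uniqueness and the L^2 bound. *)
Lemma det_neq0_resolvent : \det M != 0 -> bloch_resolvent_set a q theta1 theta2
  lambda.
Proof.
move=> M0; have Mu : M \in unitmx by rewrite unitmxE unitfE.
have [m m0 mP] := edge_solution_bounded.
have [d d0 dP] := defect_bounded.
pose X f : 'cV[R[i]]_12 := - (invmx M *m \col_i (defect f)`_i).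
pose A f (j : 'I_6) := X f (inord j) 0;
  pose B f (j : 'I_6) := X f (inord (6 + j)) 0.
(* A crude bound for the norm of the inverse matrix. *)
pose W := \sum_(k < 12) \sum_(i < 12) taxi (invmx M k i).
have W0 : 0 <= W by do 2 (apply: sumr_ge0 => ? _); exact: taxi_ge0.
have taxi_sum (F : 'I_12 -> R[i]) : taxi (\sum_i F i) <= \sum_i taxi (F i).
  elim/big_ind2: _ => [|u s v t hu hv|//]; first by rewrite taxi0.
  by apply: le_trans (taxiD _ _) _; exact: lerD.
have T0 f : 0 <= total_taxi f.
  by apply: sumr_ge0 => j _; apply: int0_ge0 => t _; exact: taxi_ge0.
have Xle f k : bloch_L2 a theta1 theta2 f -> taxi (X f k 0) <= W * (d *
  total_taxi f).
  move=> fL2; rewrite !mxE taxiN; apply: le_trans (taxi_sum _) _.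
  apply: (@le_trans _ _ (\sum_i taxi (invmx M k i) * (d * total_taxi f))).
    apply: ler_sum => i _; apply: le_trans (taxiM _ _) _.
    by apply: ler_wpM2l; rewrite ?taxi_ge0 // mxE dP.
  rewrite -mulr_suml ler_wpM2r ?mulr_ge0 // /W [leRHS](bigD1 k) //= lerDl.
  by do 2 (apply: sumr_ge0 => ? _); exact: taxi_ge0.
have ABP f i : (bloch_forms (C^~ a) (C'^~ a) (S^~ a) (S'^~ a) al be (A f) (B f))`_i
     + (defect f)`_i = 0.
  case: (ltnP i 12) => i12; last by rewrite !nth_default // addr0.
  rewrite -(bloch_matrix_mul _ _ _ _ _ _ (X f) (Ordinal i12)) -/M.
  by rewrite mulmxN mulmxA mulmxV // mul1mx !mxE addNr.
(* Both coefficients on an edge are at most [W * d] times the L^1 norm of [f], and that norm itself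
   accounts for the 1; [m] comes from the edge bound. *)
pose K := m * (2 * (W * d) + 1).
(* Six edges, each with squared norm at most (K T)^2 a, where T is [total_taxi f] and T^2 is at most
   72 a times the squared L^2 norm of [f]. *)
exists (6 * (K ^+ 2 * 72 * a * a)) => f fL2 /=.
have ysol := solves_edge_solution fL2 (ABP f).
exists (bloch_extension (edge_solution C S (A f) (B f) f)); split=> //.
  have fE : bloch_normsq a f = (\sum_j int0 (fun t => sqnorm (f (j, 0) t)) a)%:E.
    rewrite /bloch_normsq -sumEFin; apply: eq_bigr => j _.
    by rewrite L2sqE //; exact: fL2.2.
  have Tle := sqr_total_taxi_le fL2.
  rewrite fE -EFinM; set N := \sum_j _ in Tle *.
  apply: (@le_trans _ _ (\sum_(j < 6) ((K * total_taxi f) ^+ 2 * a)%:E)%E).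
    apply: lee_sum => j _; rewrite /bloch_extension /= phase0.
    rewrite (_ : (fun x => _) = edge_solution C S (A f) (B f) f j); last first.
      by apply/funext => x; rewrite mul1r.
    apply: L2sq_le => //.
      by have [yp _] := edge_solution_sol (A f) (B f) j fL2;
        exact: ac_primitive_isL2 yp.
    move=> t ta; apply: le_trans (mP (A f) (B f) f j t fL2 ta).1 _.
    rewrite /K -mulrA; apply: ler_wpM2l => //.
    have := Xle f (inord j) fL2; have := Xle f (inord (6 + j)) fL2.
    by rewrite -/(A f j) -/(B f j); lra.
  rewrite sumEFin lee_fin sumr_const card_ord.
  have -> : (K * total_taxi f) ^+ 2 * a *+ 6 = 6 * (K ^+ 2 * a * total_taxi f
    ^+ 2) by ring.
  have -> : 6 * (K ^+ 2 * 72 * a * a) * N = 6 * (K ^+ 2 * a * (72 * a * N)) by ring.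
  have K2 : 0 <= K ^+ 2 * a := mulr_ge0 (sqr_ge0 K) a0.
  rewrite ler_pM2l ?ltr0n //; exact: (ler_wpM2l K2 Tle).
move=> y1 /(solves_unique fL2)[A1 [B1 [AB1 y1E]]] e x xa; rewrite y1E //.
(* The coefficients of any other solution, stacked in one column, satisfy the same invertible
   system. *)
pose X1 : 'cV[R[i]]_12 := \col_k (if (k < 6)%N then A1 (inord k) else B1 (inord
  (k - 6))).
have A1E j : A1 j = X1 (inord j) 0.
  have j12 : (j < 12)%N by have := ltn_ord j; lia.
  by rewrite mxE inordK // ltn_ord inord_val.
have B1E j : B1 j = X1 (inord (6 + j)) 0.
  have j12 : (6 + j < 12)%N by have := ltn_ord j; lia.
  by rewrite mxE inordK // ltnNge leq_addr /= addKn inord_val.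
have X1X : X1 = X f.
  have : M *m X1 = - \col_i (defect f)`_i.
    apply/colP => i; rewrite bloch_matrix_mul !mxE.
    have := AB1 i; rewrite (_ : A1 = fun j => X1 (inord j) 0); last by apply/funext.
    rewrite (_ : B1 = fun j => X1 (inord (6 + j)) 0); last by apply/funext.
    by move/eqP; rewrite addr_eq0 => /eqP.
  by move=> h; rewrite /X -mulmxN -h mulKmx.
have -> : A1 = A f by apply/funext => j; rewrite (A1E j) X1X.
have -> : B1 = B f by apply/funext => j; rewrite (B1E j) X1X.
by [].
Qed.

End BlochResolvent.

(** * Spectral equivalence and trigonometric form of the dispersion relation *)

Theorem theorem5p1 (R : realType) (a : R) (q : 'I_6 -> R -> R)
    (a_gt0 : 0 < a)
    (q_L2 : forall j : 'I_6, isL2 a (fun x => (q j x)%:C))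
    (rho : R[i]) (C C' S S' : 'I_6 -> R -> R[i])
    (C_sol : forall j : 'I_6, solution a (q j) (rho ^+ 2) (C j) (C' j))
    (C_init : forall j : 'I_6, C j 0 = 1 /\ C' j 0 = 0)
    (S_sol : forall j : 'I_6, solution a (q j) (rho ^+ 2) (S j) (S' j))
    (S_init : forall j : 'I_6, S j 0 = 0 /\ S' j 0 = 1)
    (theta1 theta2 : R)
    (theta1_pi : - pi <= theta1 <= pi)
    (theta2_pi : - pi <= theta2 <= pi) :
  let c j := C j a in
  let c' j := C' j a in
  let s j := S j a in
  let s' j := S' j a in
  let Phi := bloch_charfun c c' s s' (expi theta1) (expi theta2) in
  (bloch_spectrum a q theta1 theta2 (rho ^+ 2) <-> Phi = 0) /\
  Phi =
    - expi (2 * (theta1 + theta2)) *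
    (2 * ((s.{1} * s.{2} * s.{4} + s.{3} * s.{5} * s.{6}) * (cos theta1)%:C
          + (s.{1} * s.{3} * s.{5} + s.{2} * s.{4} * s.{6})
            * (cos (theta1 - theta2))%:C
          + (s.{1} * s.{4} * s.{5} + s.{2} * s.{3} * s.{6}) * (cos theta2)%:C
          + s.{1} * s.{2} * s.{3} + s.{4} * s.{5} * s.{6})
     + SSSS' s s' 2 3 4 5 * (2 * (cos theta2)%:C - CS' c c' s s' 1 6)
     + CSSS c s 1 3 4 6 * (2 * (cos (theta1 - theta2))%:C - CS' c c' s s' 2 5)
     - SS' s s' 1 6 * SS' s s' 2 5 * CS c s 3 4
     - SS' s s' 3 4 * CS c s 2 5 * CS c s 1 6
     + (s.{1} * s.{6} * CS c s 2 5 + s.{2} * s.{5} * SS' s s' 1 6)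
       * (2 * (cos theta1)%:C - CS' c c' s s' 3 4)).
Proof.
move=> c c' s s' Phi; split.
  split=> [spec|Phi0 res].
    apply/eqP; apply: contra_notT spec.
    exact: (det_neq0_resolvent a_gt0 C_sol C_init S_sol S_init).
  have := resolvent_det_neq0 a_gt0 C_sol C_init S_sol S_init res.
  by rewrite -/(bloch_charfun _ _ _ _ _ _) -/Phi Phi0 eqxx.
have W j : c j * s' j - c' j * s j = 1.
  have [C0 C'0] := C_init j; have [_ S'0] := S_init j.
  have aa : 0 <= a <= a by rewrite lexx ltW.
  exact: (wronskian_CS a_gt0 (C_sol j) C0 C'0 (S_sol j) S'0 aa).
(* The inverse phases are those of the opposite angles, so that symmetric sums of phases become
   twice a cosine. *)
rewrite /Phi (bloch_charfunE W (expiNK theta1) (expiNK theta2)).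
have -> : expi (2 * (theta1 + theta2)) = expi theta1 ^+ 2 * expi theta2 ^+ 2.
  by rewrite !expr2 -!expiD; congr expi; ring.
rewrite !expi_addN.
have -> : expi theta1 * expi (- theta2) + expi (- theta1) * expi theta2 =
    2 * (cos (theta1 - theta2))%:C.
  by rewrite -expi_addN opprB -!expiD [- theta1 + _]addrC.
ring.
Qed.
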